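(* Let $A$ be a commutative, unital, complex Banach algebra with maximal ideal space $\Omega$ and let $\alpha(x)$ be a monic polynomial over $A$. Let $A_\alpha$ be the Arens–Hoffman extension of $A$ by $\alpha(x)$, and let $\Omega_\alpha$ be its maximal ideal space. Then (i) if $a\in A$ and $a\in e^{A_\alpha}$ then $a\in e^{A}$; and (ii) $H^1(\Omega_\alpha,\mathbb{Z})=0$ implies that $H^1(\Omega,\mathbb{Z})=0$.
   Context: Monic polynomials have degree $n\ge 1$. For $\alpha(x)=a_0+\cdots+a_{n-1}x^{n-1}+x^n$ monic over $A$, the Arens–Hoffman extension is $A_\alpha=A[x]/(\alpha(x))$; writing $\bar x$ for the coset of $x$, each element has a unique expression $\sum_{k=0}^{n-1}b_k\bar x^k$ with $b_k\in A$, and it is normed by $\|\sum_{k=0}^{n-1}b_k\bar x^k\|=\sum_{k=0}^{n-1}\|b_k\|t^k$ for a fixed $t>0$ with $t^n\ge\sum_{k=0}^{n-1}\|a_k\|t^k$. This is a Banach algebra containing $A$ isometrically via $a\mapsto(\alpha(x))+a$, and $A$ is identified with its image. For a Banach algebra $B$, $e^{B}=\{e^b: b\in B\}$. $H^1(X,\mathbb{Z})$ is the first Čech cohomology group with integer coefficients of the compact Hausdorff space $X$. *)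

(* Defs.v *)
From HB Require Import structures.
From mathcomp Require Import all_boot all_order all_algebra.
From mathcomp Require Import generic_quotient qpoly complex.
From mathcomp Require Import boolp classical_sets functions reals topology.
From mathcomp Require Import normedtype sequences.
Set Implicit Arguments.
Unset Strict Implicit.
Unset Printing Implicit Defensive.
Import Order.TTheory GRing.Theory Num.Theory.
Import numFieldNormedType.Exports.
Local Open Scope classical_set_scope.
Local Open Scope quotient_scope.
Local Open Scope ring_scope.

(* Commutative unital Banach algebras.  The ring hierarchy and [normedModType]
   cannot be joined in one HB structure ([numDomainType] already inherits from
   both), so the norm is a mixin over [comAlgType], from which the
   library's normed module structure is derived.  As in the library, norms
   take their values in the scalar field [K]; the complex case is [K := R[i]]. *)
HB.mixin Record ComAlgebra_isNormed (K : numFieldType) (A : Type)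
    & GRing.ComAlgebra K A := {
  alg_norm : A -> K ;
  alg_normD : forall x y : A, alg_norm (x + y) <= alg_norm x + alg_norm y ;
  alg_normZ : forall (c : K) (x : A), alg_norm (c *: x) = `|c| * alg_norm x ;
  alg_norm0_eq0 : forall x : A, alg_norm x = 0 -> x = 0 ;
  alg_normM : forall x y : A, alg_norm (x * y) <= alg_norm x * alg_norm y ;
  alg_norm1 : alg_norm 1 = 1
}.

#[short(type="comNormedAlgType")]
HB.structure Definition ComNormedAlgebra (K : numFieldType) :=
  {A of GRing.ComAlgebra K A & ComAlgebra_isNormed K A}.

HB.instance Definition _ (K : numFieldType) (A : comNormedAlgType K) :=
  @Lmodule_isNormed.Build K A (@alg_norm K A)
    (@alg_normD K A) (@alg_normZ K A) (@alg_norm0_eq0 K A).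

Definition norm_complete (K : numFieldType) (A : comNormedAlgType K) :=
  forall F : set_system A, ProperFilter F -> cauchy F -> cvg F.

HB.mixin Record ComNormedAlgebra_isComplete (K : numFieldType) (A : Type)
    & ComNormedAlgebra K A := {
  alg_complete : norm_complete A
}.

#[short(type="comBanachAlgType")]
HB.structure Definition ComBanachAlgebra (K : numFieldType) :=
  {A of ComNormedAlgebra K A & ComNormedAlgebra_isComplete K A}.

HB.instance Definition _ (K : numFieldType) (A : comBanachAlgType K) :=
  NormedModule.copy A (A : comNormedAlgType K).
HB.instance Definition _ (K : numFieldType) (A : comBanachAlgType K) :=
  Uniform_isComplete.Build A (@alg_complete K A).

Definition banach_exp (K : numFieldType) (A : comBanachAlgType K) (b : A) : A :=
  limn (series (fun k => (k`!%:R)^-1 *: b ^+ k)).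

(* the set e^A *)
Definition exp_set (K : numFieldType) (A : comBanachAlgType K) : set A :=
  range (@banach_exp K A).
Arguments exp_set {K} A.

(* The maximal ideal space as the space of characters: a nonzero multiplicative
   functional is unital, hence an [lrmorphism], and is automatically continuous.
   It carries the Gelfand topology, i.e. that of pointwise convergence on [A]. *)
Definition max_ideal_space (K : numFieldType) (A : comBanachAlgType K) : Type :=
  {lrmorphism A -> K^o}.

Section gelfand_topology.
Context (K : numFieldType) (A : comBanachAlgType K).
HB.instance Definition _ := gen_eqMixin (max_ideal_space A).
HB.instance Definition _ := gen_choiceMixin (max_ideal_space A).

Definition gelfand_eval (phi : max_ideal_space A) : {ptws A -> K^o} :=
  (phi : {lrmorphism A -> K^o}).

HB.instance Definition _ :=
  Topological.copy (max_ideal_space A) (initial_topology gelfand_eval).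
End gelfand_topology.

(* A[x]/(alpha), of degree n = (size alpha).-1.  The carrier ignores [t] and
   the hypotheses, but the norm and its properties depend on them.
   [{poly %/ alpha}] is the quotient by [alpha] only when [alpha] is monic of
   positive degree; its elements are the representatives of degree < n. *)
Definition arens_hoffman (K : numFieldType) (A : comBanachAlgType K)
    (alpha : {poly A}) (t : K)
    (alpha_monic : alpha \is monic) (alpha_deg : (1 < size alpha)%N)
    (t_gt0 : 0 < t)
    (t_ge : \sum_(k < (size alpha).-1) `|alpha`_k| * t ^+ k
              <= t ^+ (size alpha).-1) : Type :=
  {poly %/ alpha}.

Section arens_hoffman.
Context (K : numFieldType) (A : comBanachAlgType K) (alpha : {poly A}) (t : K).
Local Notation n := (size alpha).-1.
Hypotheses (alpha_monic : alpha \is monic) (alpha_deg : (1 < size alpha)%N).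
Hypotheses (t_gt0 : 0 < t) (t_ge : \sum_(k < n) `|alpha`_k| * t ^+ k <= t ^+ n).

Local Notation Aalpha := (arens_hoffman alpha_monic alpha_deg t_gt0 t_ge).

HB.instance Definition _ := GRing.ComNzRing.copy Aalpha {poly %/ alpha}.

Definition ah_scale (c : K) (q : Aalpha) : Aalpha :=
  (c%:A : A) *: (q : {poly %/ alpha}).

Lemma ah_scaleA c d q : ah_scale c (ah_scale d q) = ah_scale (c * d) q.
Proof. by rewrite /ah_scale scalerA -scalerAl mul1r scalerA. Qed.
Lemma ah_scale1 : left_id 1 ah_scale.
Proof. by move=> q; rewrite /ah_scale !scale1r. Qed.
Lemma ah_scaleDr : right_distributive ah_scale +%R.
Proof. by move=> c p q; rewrite /ah_scale scalerDr. Qed.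
Lemma ah_scaleDl q : {morph ah_scale^~ q : c d / c + d}.
Proof. by move=> c d; rewrite /ah_scale !scalerDl. Qed.
HB.instance Definition _ := GRing.Zmodule_isLmodule.Build K Aalpha
  ah_scaleA ah_scale1 ah_scaleDr ah_scaleDl.

Lemma ah_scaleAl (c : K) (p q : Aalpha) : c *: (p * q) = (c *: p) * q.
Proof. exact: (@scalerAl A {poly %/ alpha}). Qed.
HB.instance Definition _ := GRing.Lmodule_isLalgebra.Build K Aalpha
  ah_scaleAl.
HB.instance Definition _ := GRing.Lalgebra_isComAlgebra.Build K Aalpha.

Let mk_alpha : mk_monic alpha = alpha.
Proof. by rewrite /mk_monic alpha_deg alpha_monic. Qed.

Let size_ah (q : Aalpha) : (size (q : {poly %/ alpha}) <= n)%N.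
Proof.
have nE : n.+1 = size (mk_monic alpha).
  by rewrite mk_alpha prednK// (leq_trans _ alpha_deg).
by rewrite -ltnS nE; exact: size_mk_monic.
Qed.

Let tX_ge0 k : 0 <= t ^+ k. Proof. exact/exprn_ge0/ltW. Qed.

Definition ah_norm (q : Aalpha) : K :=
  \sum_(k < n) `|(q : {poly %/ alpha})`_k| * t ^+ k.

Let ah_normD p q : ah_norm (p + q) <= ah_norm p + ah_norm q.
Proof.
rewrite -big_split/=; apply: ler_sum => k _.
by rewrite -mulrDl coefD; apply: ler_wpM2r => //; exact: ler_normD.
Qed.

Let ah_normZ (c : K) (q : Aalpha) : ah_norm (c *: q) = `|c| * ah_norm q.
Proof.
rewrite mulr_sumr; apply: eq_bigr => k _.
by rewrite coefZ mulr_algl normrZ mulrA.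
Qed.

Let ah_norm0_eq0 (q : Aalpha) : ah_norm q = 0 -> q = 0.
Proof.
move=> /eqP; rewrite psumr_eq0; last first.
  by move=> k _; exact: mulr_ge0.
move=> /allP q0; apply/val_inj/polyP => k; rewrite coef0.
have [kn|nk] := ltnP k n; last first.
  by rewrite nth_default// (leq_trans _ nk)// size_ah.
have := q0 (Ordinal kn) (mem_index_enum _).
by rewrite /= mulf_eq0 expf_eq0 (gt_eqF t_gt0) andbF orbF normr_eq0 => /eqP.
Qed.

Let M (p : {poly A}) : K := \sum_(k < size p) `|p`_k| * t ^+ k.

Let M_trunc (p : {poly A}) m : (size p <= m)%N -> M p = \sum_(k < m) `|p`_k| * t ^+ k.
Proof.
move=> pm; rewrite /M -(subnKC pm) big_split_ord/= [X in _ + X]big1 ?addr0// => k _.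
by rewrite nth_default ?normr0 ?mul0r// leq_addr.
Qed.

Let MD (p q : {poly A}) : M (p + q) <= M p + M q.
Proof.
pose m := maxn (size (p + q)) (maxn (size p) (size q)).
rewrite !(@M_trunc _ m) ?leq_max ?leqnn ?orbT//.
rewrite -big_split/=; apply: ler_sum => k _.
by rewrite -mulrDl coefD; apply: ler_wpM2r => //; exact: ler_normD.
Qed.

Let M_ge0 (p : {poly A}) : 0 <= M p.
Proof. by apply: sumr_ge0 => k _; exact: mulr_ge0. Qed.

Let MZX (c : A) m (p : {poly A}) : M (c *: ('X^m * p)) <= `|c| * t ^+ m * M p.
Proof.
rewrite (@M_trunc _ (m + size p)%N); last first.
  rewrite (leq_trans (size_scale_leq _ _))// (leq_trans (size_polyMleq _ _))//.
  by rewrite size_polyXn.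
rewrite big_split_ord/= big1 ?add0r => [|k _]; last first.
  by rewrite coefZ coefXnM ltn_ord mulr0 normr0 mul0r.
rewrite mulr_sumr; apply: ler_sum => k _.
rewrite coefZ coefXnM ltnNge leq_addr/= addKn exprD mulrACA.
by apply: ler_wpM2r; [exact: mulr_ge0|exact: alg_normM].
Qed.

Let M_small (q : Aalpha) : M (q : {poly %/ alpha}) = ah_norm q.
Proof. exact/M_trunc/size_ah. Qed.

Let in_ah (p : {poly A}) : Aalpha := in_qpoly alpha p.

Let in_ah_le (p : {poly A}) : ah_norm (in_ah p) <= M p.
Proof.
have [m] := ubnP (size p); elim: m p => // m IH p pm.
have [pn|np] := leqP (size p) n.
  rewrite -M_small in_qpoly_small// mk_alpha (leq_ltn_trans pn)//.
  by rewrite prednK// (leq_trans _ alpha_deg).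
pose l := (size p).-1; pose c := p`_l.
have pl : size p = l.+1 by rewrite /l prednK// (leq_ltn_trans _ np).
have nl : (n <= l)%N by rewrite -ltnS -pl.
have an : size alpha = n.+1 by rewrite prednK// (leq_trans _ alpha_deg).
pose r := \poly_(k < l) p`_k; pose low := \poly_(k < n) alpha`_k.
have pE : p = r + c *: 'X^l.
  apply/polyP => k; rewrite coefD coef_poly coefZ coefXn.
  have [kl|kl|->] := ltngtP k l; rewrite ?mulr0 ?addr0 ?mulr1 ?add0r//.
  by rewrite nth_default// pl.
have aE : alpha = low + 'X^n.
  apply/polyP => k; rewrite coefD coef_poly coefXn.
  have [kl|kl|->] := ltngtP k n; rewrite ?addr0 ?add0r//.
    by rewrite nth_default// an.
  by move/monicP: alpha_monic; rewrite /lead_coef.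
have lowM : M low <= t ^+ n.
  rewrite (@M_trunc _ n) ?size_poly//; apply: le_trans t_ge.
  by apply: ler_sum => k _; rewrite coef_poly ltn_ord.
pose p' := r - c *: ('X^(l - n) * low).
have Hpp' : in_ah p = in_ah p'.
  have -> : p = p' + c *: ('X^(l - n) * alpha).
    rewrite [X in _ * X]aE mulrDr -exprD subnK// scalerDr addrA subrK; exact: pE.
  rewrite /in_ah in_qpolyD in_qpolyZ in_qpolyM [X in _ * X](_ : _ = 0).
    by rewrite mulr0 scaler0 addr0.
  by apply/val_inj => /=; rewrite mk_alpha Pdiv.RingMonic.rmodpp.
have szp' : (size p' <= l)%N.
  rewrite (leq_trans (size_polyD _ _))// geq_max size_poly/= size_polyN.
  rewrite (leq_trans (size_scale_leq _ _))//.
  rewrite (leq_trans (size_polyMleq _ _))// size_polyXn addSn/=.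
  by rewrite -[leqRHS](subnK nl) leq_add2l size_poly.
rewrite Hpp'; apply: (le_trans (IH _ _)).
  by rewrite (leq_ltn_trans szp')// -ltnS -pl.
rewrite /p' -scaleNr; apply: (le_trans (MD _ _)).
apply: (@le_trans _ _ (M r + `|c| * t ^+ l)).
  rewrite lerD2l; apply: (le_trans (MZX _ _ _)).
  rewrite normrN -mulrA; apply: ler_wpM2l => //.
  by rewrite -[in leRHS](subnK nl) exprD; apply: ler_wpM2l.
rewrite [leRHS](@M_trunc _ l.+1) ?pl// big_ord_recr/= lerD2r.
rewrite (@M_trunc _ l) ?size_poly//.
by apply: ler_sum => k _; rewrite coef_poly ltn_ord.
Qed.

Let MM (p q : {poly A}) : M (p * q) <= M p * M q.
Proof.
have MD_sum m (F : 'I_m -> {poly A}) : M (\sum_(i < m) F i) <= \sum_(i < m) M (F i).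
  elim/big_ind2: _ => [|a b c d ab cd|//]; first by rewrite /M size_poly0 big_ord0.
  exact: le_trans (MD _ _) (lerD ab cd).
rewrite -{1}[p]coefK poly_def mulr_suml; apply: (le_trans (MD_sum _ _)).
rewrite [X in _ <= X * _]/M mulr_suml; apply: ler_sum => k _.
by rewrite -scalerAl; exact: MZX.
Qed.

Let ah_normM (p q : Aalpha) : ah_norm (p * q) <= ah_norm p * ah_norm q.
Proof.
rewrite -(M_small p) -(M_small q).
have pqE : p * q =
    in_ah (((p : {poly %/ alpha}) : {poly A}) * ((q : {poly %/ alpha}) : {poly A})).
  by [].
by rewrite pqE; apply: (le_trans (in_ah_le _)); exact: MM.
Qed.

Let ah_norm1 : ah_norm 1 = 1.
Proof.
rewrite -M_small /= /M polyseq1 big_ord_recl big_ord0 addr0/=.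
by rewrite expr0 mulr1; exact: alg_norm1.
Qed.

HB.instance Definition _ := @ComAlgebra_isNormed.Build K Aalpha ah_norm
  ah_normD ah_normZ ah_norm0_eq0 ah_normM ah_norm1.
HB.instance Definition _ :=
  NormedModule.copy Aalpha (Aalpha : comNormedAlgType K).

Let coef_ah (k : nat) (q : Aalpha) : A := (q : {poly %/ alpha})`_k.

Let coef_ah_le (k : 'I_n) (q : Aalpha) : `|coef_ah k q| * t ^+ k <= `|q|.
Proof.
rewrite [leRHS](bigD1 k)//= lerDl.
by apply: sumr_ge0 => i _; exact: mulr_ge0.
Qed.

Let ah_complete : norm_complete Aalpha.
Proof.
move=> F PF cF.
have n_gt0 : (0 < n)%N by rewrite -ltnS prednK// (leq_trans _ alpha_deg).
have tX_gt0 k : 0 < t ^+ k by exact: exprn_gt0.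
have cvg_coef (k : 'I_n) : cvg (coef_ah k @ F).
  apply: cauchy_cvg; apply/cauchy_ballP => e e0.
  have et0 : 0 < e * t ^+ k by exact: mulr_gt0.
  have /cauchy_ballP/(_ _ et0) := cF.
  case=> -[P Q] /= [FP FQ] PQ.
  exists (coef_ah k @` P, coef_ah k @` Q).
    split => /=; [apply: filterS FP|apply: filterS FQ] => x Px /=; exact: imageP.
  move=> [_ _] [/= [x Px <-] [y Qy <-]].
  have := PQ (x, y) (conj Px Qy).
  rewrite -!ball_normE /ball_ /= => xye.
  rewrite -(ltr_pM2r (tX_gt0 k)); apply: le_lt_trans xye.
  by apply: le_trans (coef_ah_le k _); rewrite /coef_ah coefB.
pose l (k : nat) : A := if insub k is Some i then lim (coef_ah (i : 'I_n) @ F) else 0.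
pose q : Aalpha := in_ah (\poly_(k < n) l k).
have coefq (k : 'I_n) : coef_ah k q = lim (coef_ah k @ F).
  rewrite /coef_ah /q /in_ah in_qpoly_small ?mk_alpha; last first.
    by rewrite (leq_ltn_trans (size_poly _ _))// prednK// (leq_trans _ alpha_deg).
  by rewrite coef_poly ltn_ord /l valK.
apply/cvg_ex; exists q; apply/cvgrPdist_lt => e e0.
have Hk (k : 'I_n) : \forall x \near F, `|coef_ah k q - coef_ah k x| < e / n%:R / t ^+ k.
  have /cvgrPdist_lt := cvg_coef k; rewrite -coefq; apply.
  by rewrite !divr_gt0// ltr0n.
have FH := filter_forall PF Hk.
apply: filterS FH => x Hx.
rewrite [ltLHS](_ : _ = \sum_(k < n) `|coef_ah k q - coef_ah k x| * t ^+ k); last first.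
  by apply: eq_bigr => k _; rewrite /coef_ah coefB.
have -> : e = \sum_(k < n) e / n%:R.
  by rewrite sumr_const card_ord -[RHS]mulr_natr divfK// pnatr_eq0 -lt0n.
apply: ltr_sum => [|k _]; last by rewrite -ltr_pdivlMr//; exact: Hx.
by apply/hasP; exists (Ordinal n_gt0) => //; exact: mem_index_enum.
Qed.

HB.instance Definition _ := ComNormedAlgebra_isComplete.Build K Aalpha ah_complete.

(* the embedding a |-> (alpha(x)) + a *)
Definition ah_inj (a : A) : Aalpha := in_qpoly alpha a%:P.

Lemma ah_inj_isometric (a : A) : `|ah_inj a| = `|a|.
Proof.
have <- : M a%:P = `|ah_inj a|.
  rewrite /ah_inj -[RHS]M_small in_qpoly_small// size_polyC mk_alpha.
  by apply: leq_ltn_trans alpha_deg; case: (a != 0).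
rewrite (@M_trunc _ 1) ?size_polyC ?leq_b1// big_ord_recl big_ord0 addr0.
by rewrite coefC expr0 mulr1.
Qed.

End arens_hoffman.

(* First Cech cohomology group of [X] with coefficients in [G]: the direct limit,
   over the open coverings of [X] ordered by refinement, of the first (ordered)
   simplicial cohomology group of the nerve.  Coverings are sets of open sets.
   Cochains are total functions whose values off the simplices of the nerve
   (tuples of members with nonempty intersection) are irrelevant. *)
Section cech.
Context (X : topologicalType) (G : zmodType).
Implicit Types (UU VV WW : set (set X)) (r s : set X -> set X).

Definition is_open_covering UU :=
  (forall U, UU U -> open U) /\ \bigcup_(U in UU) U = setT.

Definition is_refinement_map VV UU r :=
  forall V, VV V -> UU (r V) /\ V `<=` r V.

Definition is_1cocycle UU (c : set X -> set X -> G) :=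
  forall U V W, UU U -> UU V -> UU W -> U `&` V `&` W !=set0 ->
    c V W - c U W + c U V = 0.

Definition is_1coboundary UU (c : set X -> set X -> G) :=
  exists g : set X -> G,
    forall U V, UU U -> UU V -> U `&` V !=set0 -> c U V = g V - g U.

Record cech_1cocycle := CechCocycle {
  cech_covering : set (set X) ;
  cech_cochain : set X -> set X -> G ;
  cech_coveringP : is_open_covering cech_covering ;
  cech_cochainP : is_1cocycle cech_covering cech_cochain
}.

HB.instance Definition _ := gen_eqMixin cech_1cocycle.
HB.instance Definition _ := gen_choiceMixin cech_1cocycle.

(* equality in the direct limit: c and d become cohomologous on some common
   refinement of their coverings *)
Definition cech_cohomologous (c d : cech_1cocycle) : Prop :=
  exists WW r s, [/\ is_open_covering WW,
    is_refinement_map WW (cech_covering c) r,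
    is_refinement_map WW (cech_covering d) s &
    is_1coboundary WW (fun U V =>
      cech_cochain c (r U) (r V) - cech_cochain d (s U) (s V))].

Let ref_id UU : is_refinement_map UU UU id.
Proof. by move=> U ?; split. Qed.

Let ref_comp UU VV WW r s : is_refinement_map WW VV s ->
  is_refinement_map VV UU r -> is_refinement_map WW UU (r \o s).
Proof.
move=> ws vr W /ws[Ws sW]; have [? ?] := vr _ Ws; split => //=.
exact: subset_trans sW _.
Qed.

Let cob_eq UU c d : (forall U V, c U V = d U V) ->
  is_1coboundary UU c -> is_1coboundary UU d.
Proof. by move=> cd [g gP]; exists g => U V *; rewrite -cd gP. Qed.

Let cobD UU c d : is_1coboundary UU c -> is_1coboundary UU d ->
  is_1coboundary UU (fun U V => c U V + d U V).
Proof.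
move=> [g gP] [h hP]; exists (fun U => g U + h U) => U V Uu Vu UV.
by rewrite gP// hP// opprD addrACA.
Qed.

Let cobN UU c : is_1coboundary UU c -> is_1coboundary UU (fun U V => - c U V).
Proof.
move=> [g gP]; exists (fun U => - g U) => U V Uu Vu UV.
by rewrite gP// opprD.
Qed.

Let cob_pull UU VV r c : is_refinement_map VV UU r -> is_1coboundary UU c ->
  is_1coboundary VV (fun U V => c (r U) (r V)).
Proof.
move=> vr [g gP]; exists (g \o r) => U V /vr[? Ur] /vr[? Vr] [x [Ux Vx]].
by rewrite gP//; exists x; split; [exact: Ur|exact: Vr].
Qed.

(* any two refinement maps induce the same map in cohomology *)
Lemma is_1coboundary_refinement WW (c : cech_1cocycle) r s :
  is_refinement_map WW (cech_covering c) r ->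
  is_refinement_map WW (cech_covering c) s ->
  is_1coboundary WW (fun U V =>
    cech_cochain c (r U) (r V) - cech_cochain c (s U) (s V)).
Proof.
move=> wr ws; exists (fun U => cech_cochain c (s U) (r U)).
move=> U V /[dup] /wr[rUc Ur] /ws[sUc Us] /[dup] /wr[rVc Vr] /ws[sVc Vs].
move=> [x [Ux Vx]].
have P1 : s U `&` r U `&` r V !=set0.
  by exists x; split; [split; [exact: Us|exact: Ur]|exact: Vr].
have P2 : s U `&` s V `&` r V !=set0.
  by exists x; split; [split; [exact: Us|exact: Vs]|exact: Vr].
have := cech_cochainP sUc rUc rVc P1; have := cech_cochainP sUc sVc rVc P2.
move=> /eqP; rewrite -addrA addr_eq0 opprD opprK => /eqP ->.
move=> /eqP; rewrite -addrA addr_eq0 opprD opprK => /eqP ->.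
by rewrite addrAC.
Qed.

(* the common refinement of UU and VV, with its projections to UU and VV *)
Definition cech_meet UU VV : set (set X) := [set U `&` V | U in UU & V in VV].

Definition cech_choice UU (W : set X) : set X := get [set U | UU U /\ W `<=` U].

Fact cech_meet_covering UU VV : is_open_covering UU -> is_open_covering VV ->
  is_open_covering (cech_meet UU VV).
Proof.
move=> [oU cU] [oV cV]; split=> [_ [U /oU ? [V /oV ? <-]]|]; first exact: openI.
rewrite -subTset => x _.
have : setT x by []. rewrite -{1}cU => -[U Uu Ux].
have : setT x by []. rewrite -{1}cV => -[V Vv Vx].
by exists (U `&` V) => //; exists U => //; exists V.
Qed.

Fact cech_choicel UU VV : is_refinement_map (cech_meet UU VV) UU (cech_choice UU).
Proof.
move=> W [U Uu [V Vv <-]].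
have /getPex// : exists U0, [set U0 | UU U0 /\ U `&` V `<=` U0] U0.
by exists U; split => //; exact: subIsetl.
Qed.

Fact cech_choicer UU VV : is_refinement_map (cech_meet UU VV) VV (cech_choice VV).
Proof.
move=> W [U Uu [V Vv <-]].
have /getPex// : exists U0, [set U0 | VV U0 /\ U `&` V `<=` U0] U0.
by exists V; split => //; exact: subIsetr.
Qed.

Let cohom_refl c : cech_cohomologous c c.
Proof.
exists (cech_covering c), id, id; split.
- exact: cech_coveringP.
- exact: ref_id.
- exact: ref_id.
by exists (fun=> 0) => U V *; rewrite !subrr.
Qed.

Let cohom_sym c d : cech_cohomologous c d -> cech_cohomologous d c.
Proof.
move=> [WW [r [s [oW wr ws cob]]]]; exists WW, s, r; split => //.
by apply: cob_eq (cobN cob) => U V; rewrite opprB.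
Qed.

Let cohom_trans c d e :
  cech_cohomologous c d -> cech_cohomologous d e -> cech_cohomologous c e.
Proof.
move=> [W1 [r1 [s1 [oW1 wr1 ws1 cob1]]]] [W2 [r2 [s2 [oW2 wr2 ws2 cob2]]]].
have wp := @cech_choicel W1 W2; have wq := @cech_choicer W1 W2.
exists (cech_meet W1 W2), (r1 \o cech_choice W1), (s2 \o cech_choice W2); split.
- exact: cech_meet_covering.
- exact: ref_comp wp wr1.
- exact: ref_comp wq ws2.
have C := is_1coboundary_refinement (ref_comp wp ws1) (ref_comp wq wr2).
apply: cob_eq (cobD (cob_pull wp cob1) (cobD C (cob_pull wq cob2))) => U V /=.
by rewrite [_ + (_ + _)]addrA !subrKA.
Qed.

Let cohomb c d := `[< cech_cohomologous c d >].
Let cohomb_equiv : equiv_class_of cohomb.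
Proof.
split=> [c|c d|d c e]; rewrite /cohomb.
- exact/asboolP/cohom_refl.
- by apply/asboolP/asboolP; exact: cohom_sym.
- by move=> /asboolP cd /asboolP de; apply/asboolP; exact: cohom_trans cd de.
Qed.
Canonical cech_cohomologous_equiv := EquivRelPack cohomb_equiv.

Definition cech_H1 : Type := {eq_quot cech_cohomologous_equiv}.
HB.instance Definition _ := Choice.on cech_H1.
HB.instance Definition _ := EqQuotient.on cech_H1.

Lemma cech_H1_eqP (c d : cech_1cocycle) :
  \pi_cech_H1 c = \pi_cech_H1 d <-> cech_cohomologous c d.
Proof.
split=> [|cd]; first by move/(@eqmodP _ cech_cohomologous_equiv)/asboolP.
by apply/(@eqmodP _ cech_cohomologous_equiv)/asboolP.
Qed.

Let cohom_on WW (c d : cech_1cocycle) r s : is_open_covering WW ->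
  is_refinement_map WW (cech_covering c) r ->
  is_refinement_map WW (cech_covering d) s ->
  is_1coboundary WW (fun U V =>
    cech_cochain c (r U) (r V) - cech_cochain d (s U) (s V)) ->
  \pi_cech_H1 c = \pi_cech_H1 d.
Proof. by move=> *; apply/cech_H1_eqP; exists WW, r, s; split. Qed.

Fact cech_zero_subproof : is_1cocycle [set setT] (fun _ _ => 0).
Proof. by move=> U V W _ _ _ _; rewrite subr0 addr0. Qed.

Fact cech_zero_covering : is_open_covering [set setT].
Proof. by split=> [_ ->|]; [exact: openT|exact: bigcup_set1]. Qed.

Definition cech_zero := CechCocycle cech_zero_covering cech_zero_subproof.

Fact cech_opp_subproof (c : cech_1cocycle) :
  is_1cocycle (cech_covering c) (fun U V => - cech_cochain c U V).
Proof.
move=> U V W Uc Vc Wc UVW.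
by rewrite -!opprD (cech_cochainP Uc Vc Wc UVW) oppr0.
Qed.

Definition cech_opp c := CechCocycle (cech_coveringP c) (@cech_opp_subproof c).

Fact cech_add_subproof (c d : cech_1cocycle) :
  is_1cocycle (cech_meet (cech_covering c) (cech_covering d)) (fun U V =>
    cech_cochain c (cech_choice (cech_covering c) U) (cech_choice (cech_covering c) V) +
    cech_cochain d (cech_choice (cech_covering d) U) (cech_choice (cech_covering d) V)).
Proof.
move=> U V W Uc Vc Wc [x [[Ux Vx] Wx]].
have [lU xU] := cech_choicel Uc; have [lV xV] := cech_choicel Vc.
have [lW xW] := cech_choicel Wc; have [rU yU] := cech_choicer Uc.
have [rV yV] := cech_choicer Vc; have [rW yW] := cech_choicer Wc.
rewrite opprD [X in X + _ = _]addrACA [LHS]addrACA (cech_cochainP lU lV lW); last first.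
  by exists x; split; [split; [exact: xU|exact: xV]|exact: xW].
rewrite add0r (cech_cochainP rU rV rW)//.
by exists x; split; [split; [exact: yU|exact: yV]|exact: yW].
Qed.

Definition cech_add c d := CechCocycle
  (cech_meet_covering (cech_coveringP c) (cech_coveringP d))
  (@cech_add_subproof c d).

Let cohom_fine (c d : cech_1cocycle) : \pi_cech_H1 c = \pi_cech_H1 d ->
  exists2 W, is_open_covering W & forall WW w r s, is_refinement_map WW W w ->
    is_refinement_map WW (cech_covering c) r ->
    is_refinement_map WW (cech_covering d) s ->
    is_1coboundary WW (fun U V =>
      cech_cochain c (r U) (r V) - cech_cochain d (s U) (s V)).
Proof.
move=> /cech_H1_eqP[W [r0 [s0 [oW wr ws cob]]]]; exists W => // WW w r s ww cr ds.
have C1 := is_1coboundary_refinement cr (ref_comp ww wr).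
have C2 := is_1coboundary_refinement (ref_comp ww ws) ds.
apply: cob_eq (cobD C1 (cobD (cob_pull ww cob) C2)) => U V /=.
by rewrite [_ + (_ + _)]addrA !subrKA.
Qed.

Let add_l WW c d r : is_refinement_map WW (cech_covering (cech_add c d)) r ->
  is_refinement_map WW (cech_covering c) (cech_choice (cech_covering c) \o r).
Proof. by move=> wr; exact: ref_comp wr (@cech_choicel _ _). Qed.

Let add_r WW c d r : is_refinement_map WW (cech_covering (cech_add c d)) r ->
  is_refinement_map WW (cech_covering d) (cech_choice (cech_covering d) \o r).
Proof. by move=> wr; exact: ref_comp wr (@cech_choicer _ _). Qed.

Let add_wd c c' d d' : \pi_cech_H1 c = \pi_cech_H1 c' ->
  \pi_cech_H1 d = \pi_cech_H1 d' ->
  \pi_cech_H1 (cech_add c d) = \pi_cech_H1 (cech_add c' d').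
Proof.
move=> /cohom_fine[W1 oW1 H1] /cohom_fine[W2 oW2 H2].
pose e := cech_add c d; pose e' := cech_add c' d'.
have oE := cech_meet_covering (cech_coveringP e) (cech_coveringP e').
have oW := cech_meet_covering oW1 oW2.
pose WW := cech_meet (cech_meet (cech_covering e) (cech_covering e')) (cech_meet W1 W2).
have we : is_refinement_map WW _ _ := ref_comp (@cech_choicel _ _) (@cech_choicel _ _).
have we' : is_refinement_map WW _ _ := ref_comp (@cech_choicel _ _) (@cech_choicer _ _).
have w1 : is_refinement_map WW _ _ := ref_comp (@cech_choicer _ _) (@cech_choicel _ _).
have w2 : is_refinement_map WW _ _ := ref_comp (@cech_choicer _ _) (@cech_choicer _ _).
apply: (@cohom_on WW _ _ _ _ (cech_meet_covering oE oW) we we').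
apply: cob_eq (cobD (H1 _ _ _ _ w1 (add_l we) (add_l we'))
                    (H2 _ _ _ _ w2 (add_r we) (add_r we'))) => U V /=.
by rewrite opprD addrACA.
Qed.

Definition cech_H1_zero : cech_H1 := \pi_cech_H1 cech_zero.
Definition cech_H1_opp (x : cech_H1) : cech_H1 := \pi_cech_H1 (cech_opp (repr x)).
Definition cech_H1_add (x y : cech_H1) : cech_H1 :=
  \pi_cech_H1 (cech_add (repr x) (repr y)).

Let addE c d : cech_H1_add (\pi_cech_H1 c) (\pi_cech_H1 d) = \pi_cech_H1 (cech_add c d).
Proof. by apply: add_wd; rewrite reprK. Qed.

Let H1_addC : commutative cech_H1_add.
Proof.
move=> x y; rewrite /cech_H1_add; set c := repr x; set d := repr y.
pose e := cech_add c d; pose e' := cech_add d c.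
have o := cech_meet_covering (cech_coveringP e) (cech_coveringP e').
have we := @cech_choicel (cech_covering e) (cech_covering e').
have we' := @cech_choicer (cech_covering e) (cech_covering e').
apply: (cohom_on o we we').
apply: cob_eq (cobD (is_1coboundary_refinement (add_l we) (add_r we'))
                    (is_1coboundary_refinement (add_r we) (add_l we'))) => U V /=.
by rewrite -/c -/d [in RHS](addrC (cech_cochain d _ _)) opprD addrACA.
Qed.

Let H1_addA : associative cech_H1_add.
Proof.
move=> x y z; rewrite -[x]reprK -[y]reprK -[z]reprK.
rewrite (addE (repr y)) (addE (repr x) (repr y)) !addE.
set a := repr x; set b := repr y; set c := repr z.
pose e := cech_add a (cech_add b c); pose e' := cech_add (cech_add a b) c.
have o := cech_meet_covering (cech_coveringP e) (cech_coveringP e').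
have we := @cech_choicel (cech_covering e) (cech_covering e').
have we' := @cech_choicer (cech_covering e) (cech_covering e').
apply: (cohom_on o we we').
apply: cob_eq (cobD (is_1coboundary_refinement (add_l we) (add_l (add_l we')))
                (cobD (is_1coboundary_refinement (add_l (add_r we)) (add_r (add_l we')))
                      (is_1coboundary_refinement (add_r (add_r we)) (add_r we')))) => U V /=.
rewrite -[X in _ = _ - X]addrA opprD [RHS]addrACA; congr (_ + _).
by rewrite opprD [RHS]addrACA.
Qed.

Let H1_add0 : left_id cech_H1_zero cech_H1_add.
Proof.
move=> x; rewrite -[x in LHS]reprK addE -[RHS]reprK; set c := repr x.
pose e := cech_add cech_zero c.
have we : is_refinement_map (cech_covering e) (cech_covering e) id by exact: ref_id.
apply: (cohom_on (cech_coveringP e) we (add_r we)).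
by exists (fun=> 0) => U V _ _ _ /=; rewrite add0r !subrr.
Qed.

Let H1_addN : left_inverse cech_H1_zero cech_H1_opp cech_H1_add.
Proof.
move=> x; rewrite /cech_H1_opp -{2}[x]reprK addE; set c := repr x.
rewrite /cech_H1_zero.
pose e := cech_add (cech_opp c) c.
have we : is_refinement_map (cech_covering e) (cech_covering e) id by exact: ref_id.
have w0 : is_refinement_map (cech_covering e) [set setT] (fun=> setT) by [].
apply: (@cohom_on _ e cech_zero _ _ (cech_coveringP e) we w0).
apply: cob_eq (is_1coboundary_refinement (add_r we) (add_l we : is_refinement_map _ (cech_covering c) _)) => U V /=.
by rewrite subr0 addrC.
Qed.

HB.instance Definition _ := GRing.isZmodule.Build cech_H1
  H1_addA H1_addC H1_add0 H1_addN.

End cech.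

(* Main.v *)
From HB Require Import structures.
Require Import Defs.
From mathcomp Require Import all_boot all_order all_algebra.
From mathcomp Require Import perm generic_quotient qpoly complex.
From mathcomp Require Import boolp classical_sets functions reals topology.
From mathcomp Require Import normedtype sequences derive exp trigo.
From mathcomp Require Import ring zify lra.
Import Order.TTheory GRing.Theory Num.Theory.
Import numFieldNormedType.Exports.
Local Open Scope classical_set_scope.
Local Open Scope ring_scope.
Set Implicit Arguments.
Unset Strict Implicit.
Unset Printing Implicit Defensive.

(** Write [n] for the degree of [alpha].  Both parts hold because going up from
    [A] to the extension and coming back down is taking an [n]-th power, resp.
    multiplying by [n], and because one can divide by [n] downstairs.

    Part (i).  The extension is a free [A]-module of rank [n], so the
    determinant of multiplication by [q] is a continuous multiplicative map
    [ah_det] from the extension to [A], with [ah_det a = a ^+ n] for [a] in [A]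
    ([ah_det_inj]).  It carries exponentials to exponentials ([ah_det_exp]):
    as [exp b] is the limit of the powers [(1 + b / m) ^ m], its image is the
    limit of [ah_det (1 + b / m) ^ m], and [ah_det (1 + b / m)] is a polynomial
    in [1 / m] of the form [1 + c / m + ...], so that the limit is [exp c].
    The engine is [cvg_power_exp]: if [m (y_m - 1)] tends to [c] then [y_m ^ m]
    tends to [exp c].  Hence [a = exp b] in the extension gives [a ^+ n = exp c]
    in [A], so [u = a exp (- c / n)] satisfies [u ^+ n = 1].  Such a [u] is an
    exponential ([exp_unity_root]): it is a combination of orthogonal
    idempotents with the [n]-th roots of unity as coefficients.

    Part (ii).  A character of the extension is a pair [(phi, z)], with [phi] a
    character of [A] and [z] a root of the complex polynomial [phi alpha], so
    the maximal ideal space of the extension maps to that of [A] with fibres of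
    [n] points counted with multiplicity, and the fibre moves continuously
    because the roots of a monic polynomial do ([ultra_roots_cvg]).  For such a
    map there is a transfer ([cech_H1_transfer]): if the pull-back of an integer
    cocycle [c] is the coboundary of [g], summing over the fibres a function
    made of [g] and [c] gives locally constant integer functions [G U] with
    [G V - G U = n c U V], and the quotients of the [G U] by [n] have coboundary
    [c]. *)

(** * Limits of finite sums and products *)

Lemma cvg_big (V : topologicalType) (op : V -> V -> V) (idx : V) (T I : Type)
    (F : set_system T) {FF : Filter F} (r : seq I) (P : pred I)
    (f : I -> T -> V) (l : I -> V) :
  (forall (g h : T -> V) (a b : V), g @ F --> a -> h @ F --> b ->
    (fun t => op (g t) (h t)) @ F --> op a b) ->
  (forall i, P i -> f i @ F --> l i) ->
  (fun t => \big[op/idx]_(i <- r | P i) f i t) @ F -->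
    \big[op/idx]_(i <- r | P i) l i.
Proof.
move=> op_cont fl; elim: r => [|i r IH].
  by rewrite big_nil; under eq_fun do rewrite big_nil; exact: cvg_cst.
rewrite big_cons; under eq_fun do rewrite big_cons.
by case: ifPn => Pi //; apply: op_cont => //; exact: fl.
Qed.

Lemma cvg_bigsum (K : numFieldType) (V : normedModType K) (T I : Type)
    (F : set_system T) {FF : Filter F} (r : seq I) (P : pred I)
    (f : I -> T -> V) (l : I -> V) :
  (forall i, P i -> f i @ F --> l i) ->
  (fun t => \sum_(i <- r | P i) f i t) @ F --> \sum_(i <- r | P i) l i.
Proof. by apply: cvg_big => g h a b; exact: cvgD. Qed.

Lemma cvg_bigprod (K : numFieldType) (T I : Type)
    (F : set_system T) {FF : Filter F} (r : seq I) (P : pred I)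
    (f : I -> T -> K^o) (l : I -> K^o) :
  (forall i, P i -> f i @ F --> l i) ->
  (fun t => \prod_(i <- r | P i) f i t : K^o) @ F -->
    (\prod_(i <- r | P i) l i : K^o).
Proof. by apply: cvg_big => g h a b; exact: (@cvgM K). Qed.

(** * Roots of a convergent family of monic polynomials *)

(** Cauchy's bound: a root with [1 < `|z|] satisfies [z ^+ n = - sum], and
    dividing by [z ^+ n.-1] bounds it by the sum of the coefficients. *)
Lemma root_norm_le (K : numFieldType) (p : {poly K}) (z : K) (n : nat) :
  p \is monic -> size p = n.+1 -> root p z ->
  `|z| <= 1 + \sum_(k < n) `|p`_k|.
Proof.
move=> /monicP p_monic pn /rootP.
have pn1 : p`_n = 1 by rewrite -p_monic /lead_coef pn.
rewrite horner_coef pn big_ord_recr/= pn1 mul1r => /eqP.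
rewrite addrC addr_eq0 => /eqP zE.
have S_ge0 : 0 <= \sum_(k < n) `|p`_k| by exact: sumr_ge0.
have [z1|z1] := real_leP (normr_real z) (real1 _).
  by rewrite (le_trans z1)// lerDl.
rewrite (@le_trans _ _ (\sum_(k < n) `|p`_k|)) ?lerDr//.
have z_gt0 := lt_trans ltr01 z1.
case: n => [|n] in pn pn1 zE S_ge0 *.
  by move: zE; rewrite expr0 big_ord0 oppr0 => /eqP; rewrite oner_eq0.
rewrite -(ler_pM2r (exprn_gt0 n z_gt0)) -exprS -normrX zE normrN.
rewrite (le_trans (ler_norm_sum _ _ _))// mulr_suml ler_sum// => k _.
by rewrite normrM normrX ler_wpM2l// ler_weXn2l ?(ltW z1)// -ltnS.
Qed.

Section ultrafilter_roots.
Context (K : numClosedFieldType) (T : Type) (F : set_system T).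
Context (FU : UltraFilter F) (n : nat).
Variables (p : T -> {poly K}) (q : {poly K}).
Hypotheses (p_monic : forall t, p t \is monic) (p_size : forall t, size (p t) = n.+1).
Hypotheses (q_monic : q \is monic) (q_size : size q = n.+1).
Hypothesis p_cvg : forall k, (fun t => (p t)`_k : K^o) @ F --> (q`_k : K^o).

Let FF : ProperFilter F := ultra_proper.

(** The roots stay bounded, so [q] evaluated at [z t] tends to 0.  This value is
    the product of the distances from [z t] to the roots of [q]; were each of
    these distances bounded below on a set of the ultrafilter, so would their
    product be. *)
Lemma ultra_root_cvg (z : T -> K) : (forall t, root (p t) (z t)) ->
  exists s, root q s /\ (z : T -> K^o) @ F --> (s : K^o).
Proof.
move=> z_root; pose M : K := 1 + \sum_(k < n) (`|q`_k| + 1).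
have M_ge1 : 1 <= M by rewrite lerDl sumr_ge0// => k _; rewrite addr_ge0.
have z_bnd : \forall t \near F, `|z t| <= M.
  have coef_bnd (k : 'I_n) : \forall t \near F, `|(p t)`_k| <= `|q`_k| + 1.
    have /cvgrPdist_lt/(_ 1 ltr01) FH := @p_cvg k; apply: filterS FH => t qp.
    rewrite -lerBlDl (le_trans (lerB_dist _ _))// distrC; exact: ltW.
  have FH := filter_forall FF coef_bnd; apply: filterS FH => t ct.
  rewrite (le_trans (root_norm_le (p_monic t) (p_size t) (z_root t)))//.
  by rewrite lerD2l; apply: ler_sum.
have qz_cvg : (fun t => q.[z t] : K^o) @ F --> (0 : K^o).
  apply/cvgr0Pnorm_lt => e e0.
  (* the n.+1 terms of q.[z t] - (p t).[z t] are each less than d * M ^+ n.+1 *)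
  pose d : K := e / ((n.+1)%:R * M ^+ n.+1).
  have d0 : 0 < d by rewrite divr_gt0// mulr_gt0 ?ltr0n// exprn_gt0// (lt_le_trans ltr01).
  have coef_near (k : 'I_n.+1) : \forall t \near F, `|q`_k - (p t)`_k| < d.
    by have /cvgrPdist_lt/(_ _ d0) := @p_cvg k.
  have FH := filter_forall FF coef_near; apply: filterS2 FH z_bnd => t ct zt.
  have -> : q.[z t] = \sum_(k < n.+1) (q`_k - (p t)`_k) * z t ^+ k.
    under eq_bigr do rewrite mulrBl; rewrite sumrB.
    have := rootP (z_root t); rewrite horner_coef p_size => ->.
    by rewrite subr0 horner_coef q_size.
  rewrite (le_lt_trans (ler_norm_sum _ _ _))//.
  rewrite (@lt_le_trans _ _ (\sum_(k < n.+1) d * M ^+ n.+1))//; last first.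
    rewrite sumr_const card_ord -mulr_natl mulrCA /d divfK//.
    by rewrite mulf_neq0 ?pnatr_eq0// expf_neq0// gt_eqF// (lt_le_trans ltr01).
  apply: ltr_sum; first by apply/hasP; exists ord0 => //; rewrite mem_index_enum.
  move=> k _; rewrite normrM normrX.
  apply: (@le_lt_trans _ _ (`|q`_k - (p t)`_k| * M ^+ n.+1)); last first.
    by rewrite ltr_pM2r// exprn_gt0// (lt_le_trans ltr01).
  apply: ler_wpM2l => //; apply: (@le_trans _ _ (M ^+ k)).
    by apply: lerXn2r => //; rewrite nnegrE// (le_trans ler01).
  by rewrite ler_weXn2l// ltnW.
have [s qE] := closed_field_poly_normal q; rewrite (monicP q_monic) scale1r in qE.
apply: contrapT => no_lim.
have far (i : 'I_(size s)) : exists e : K, 0 < e /\ F [set t | e <= `|z t - s`_i|].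
  apply: contrapT => not_far; apply: no_lim; exists s`_i; split.
    by rewrite qE root_prod_XsubC mem_nth.
  apply/cvgrPdist_lt => e e0.
  have [//|Fc] := in_ultra_setVsetC [set t | `|s`_i - z t| < e] FU.
  case: not_far; exists e; split => //; apply: filterS Fc => t /negP /=.
  by rewrite distrC -real_leNgt ?normr_real ?gtr0_real.
have /choice[e eP] := far.
have e0 : 0 < \prod_(i < size s) e i by apply: prodr_gt0 => i _; have [] := eP i.
have /cvgr0Pnorm_lt/(_ _ e0) qz_small := qz_cvg.
have FH := filter_forall FF (fun i => (eP i).2).
have [t [tf]] := filter_ex (filterI FH qz_small).
apply/negP; rewrite -real_leNgt ?normr_real ?gtr0_real// qE.
rewrite horner_prod normr_prod (big_nth 0) big_mkord.
apply: ler_prod => i _; rewrite !hornerE tf andbT; exact/ltW/(eP i).1.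
Qed.

(** Continuity of roots.  Each root has a limit, and the product of the limit
    factors takes the same values as [q], hence is [q]: the limits are the roots
    of [q] with the right multiplicities. *)
Lemma ultra_roots_cvg (z : T -> 'I_n -> K) :
  (forall t, p t = \prod_(i < n) ('X - (z t i)%:P)) ->
  exists s : 'I_n -> K, q = \prod_(i < n) ('X - (s i)%:P) /\
    forall i, (fun t => z t i : K^o) @ F --> (s i : K^o).
Proof.
move=> pE; have z_root i t : root (p t) (z t i).
  by rewrite pE (bigD1 i)//= rootM root_XsubC eqxx.
have /choice[s sP] i := ultra_root_cvg (z_root i).
exists s; split => [|i]; last by have [] := sP i.
have lim_eval w : (fun t => (p t).[w] : K^o) @ F --> (q.[w] : K^o).
  rewrite horner_coef q_size.
  under eq_fun do rewrite horner_coef p_size.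
  by apply: (@cvg_bigsum K K^o) => k _; apply: (@cvgMr_tmp K).
have lim_prod w : (fun t => (p t).[w] : K^o) @ F -->
    ((\prod_(i < n) ('X - (s i)%:P)).[w] : K^o).
  under eq_fun do rewrite pE horner_prod; rewrite horner_prod.
  apply: cvg_bigprod => i _; rewrite !hornerE.
  under eq_fun do rewrite !hornerE.
  by apply: (@cvgB K K^o); [exact: cvg_cst|have [] := sP i].
(* a nonzero difference would have more roots than its degree: 0, 1, 2, ... *)
apply/eqP; rewrite -subr_eq0; apply/negPn/negP => d_neq0.
pose d := q - \prod_(i < n) ('X - (s i)%:P).
pose nats : seq K := [seq k%:R | k <- iota 0 (size d)].
have nats_uniq : uniq nats.
  by rewrite map_inj_uniq ?iota_uniq// => a b /eqP; rewrite eqr_nat => /eqP.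
have nats_root : all (root d) nats; last first.
  by have := max_poly_roots d_neq0 nats_root nats_uniq; rewrite size_map size_iota ltnn.
apply/allP => w _; rewrite rootE !hornerE subr_eq0; apply/eqP.
exact: (@cvg_unique _ (@norm_hausdorff K K^o) _ _ _ _ (lim_eval w) (lim_prod w)).
Qed.

End ultrafilter_roots.

(** * Transfer in Cech cohomology *)

Section cech_transfer.
Local Open Scope quotient_scope.

(** Transfer for a branched covering [p] with [n] points in each fibre.  The
    hypothesis on [fib] says that the unordered fibre, counted with
    multiplicities, depends continuously on its base point: points are matched up
    to a permutation, as roots have no global labelling.
    The proof gives that [n] times the class of [c] vanishes; the class itself
    vanishes because floor division by [n] turns a primitive of [n c] into a
    primitive of [c]. *)
Lemma cech_H1_transfer (X Y : topologicalType) (p : Y -> X) (n : nat)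
    (fib : X -> 'I_n -> Y) :
  (0 < n)%N -> continuous p -> (forall x i, p (fib x i) = x) ->
  (forall x0 (O : 'I_n -> set Y), (forall i, open (O i) /\ O i (fib x0 i)) ->
     \forall x \near x0, exists s : {perm 'I_n}, forall i, O i (fib x (s i))) ->
  (forall x : cech_H1 Y int, x = 0) -> forall x : cech_H1 X int, x = 0.
Proof.
move=> n_gt0 p_cont p_fib fib_cont H1Y x; rewrite -[x]reprK.
pose c := repr x; pose UU := cech_covering c.
have [UUo UUT] : is_open_covering UU := cech_coveringP c.
have cP U V W : UU U -> UU V -> UU W -> forall z, U z -> V z -> W z ->
    cech_cochain c V W - cech_cochain c U W + cech_cochain c U V = 0.
  by move=> Uu Vu Wu z Uz Vz Wz; apply: (cech_cochainP Uu Vu Wu); exists z.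
pose pUU : set (set Y) := [set p @^-1` U | U in UU].
pose base (V : set Y) := get [set U | UU U /\ V = p @^-1` U].
have baseP V : pUU V -> UU (base V) /\ V = p @^-1` (base V).
  by move=> [U Uu <-]; apply: (@getPex _ [set U0 | UU U0 /\ _ = _]); exists U.
have pUU_cov : is_open_covering pUU.
  split=> [_ [U Uu <-]|].
    by apply: open_comp => [y _|]; [exact: p_cont|exact: UUo].
  rewrite -subTset => y _; have : setT (p y) by [].
  by rewrite -UUT => -[U Uu Uy]; exists (p @^-1` U) => //; exists U.
have pUU_coc : is_1cocycle pUU (fun V W => cech_cochain c (base V) (base W)).
  move=> U V W /baseP[Uu UE] /baseP[Vu VE] /baseP[Wu WE] [y [[Uy Vy] Wy]].
  rewrite UE in Uy; rewrite VE in Vy; rewrite WE in Wy.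
  exact: (cP _ _ _ Uu Vu Wu (p y)).
pose pc := CechCocycle pUU_cov pUU_coc.
have /cech_H1_eqP[WW [r [s0 [[WWo WWT] WWr _ [g gP]]]]] :
    \pi_(cech_H1 Y int) pc = \pi_(cech_H1 Y int) (cech_zero Y int).
  exact: (H1Y (\pi_(cech_H1 Y int) pc)).
pose b W := base (r W).
have bP W y : WW W -> W y -> UU (b W) /\ b W (p y).
  move=> /WWr[rW Wr] Wy; have [bu rE] := baseP _ rW; split => //.
  by have := Wr _ Wy; rewrite rE.
have gE W W' y : WW W -> WW W' -> W y -> W' y ->
    cech_cochain c (b W) (b W') = g W' - g W.
  by move=> Ww Ww' Wy Wy'; rewrite -gP ?subr0//; exists y.
(* Over U, the pulled-back cocycle has the two primitives g and W |-> - c (b W) U;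
   their difference k U W does not depend on the set W around a point above U. *)
pose k U W := g W + cech_cochain c (b W) U.
have k_indep U y W W' : UU U -> U (p y) -> WW W -> WW W' -> W y -> W' y ->
    k U W = k U W'.
  move=> Uu Uy Ww Ww' Wy Wy'.
  have [bu bWy] := bP _ _ Ww Wy; have [bu' bWy'] := bP _ _ Ww' Wy'.
  have := cP _ _ _ bu bu' Uu _ bWy bWy' Uy.
  rewrite (gE _ _ _ Ww Ww' Wy Wy') /k => /eqP.
  by rewrite addrAC addrA addrAC subr_eq0 subr_eq addrC => /eqP <-; rewrite addrC.
have k_diff U V y W : UU U -> UU V -> U (p y) -> V (p y) -> WW W -> W y ->
    k V W - k U W = cech_cochain c U V.
  move=> Uu Vu Uy Vy Ww Wy; have [bu bWy] := bP _ _ Ww Wy.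
  have /eqP := cP _ _ _ bu Uu Vu _ bWy Uy Vy.
  rewrite -addrA addr_eq0 => /eqP ->.
  by rewrite /k opprD addrACA subrr add0r opprD opprK.
have /choice[w wP] (y : Y) : exists W, WW W /\ W y.
  by have : setT y by []; rewrite -WWT => -[W Ww Wy]; exists W.
(* The transfer of the locally constant function k U. *)
pose G U x := \sum_i k U (w (fib x i)).
have G_locconst U x0 : UU U -> U x0 -> \forall x \near x0, G U x = G U x0.
  move=> Uu Ux0.
  have /fib_cont near_fib i : open (w (fib x0 i)) /\ w (fib x0 i) (fib x0 i).
    by have [Ww ?] := wP (fib x0 i); split => //; exact: WWo.
  have near_U : \forall x \near x0, U x by apply: open_nbhs_nbhs; split => //; exact: UUo.
  apply: filterS2 near_fib near_U => x' [s sP] Ux'.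
  rewrite /G (reindex_inj (@perm_inj _ s))/=; apply: eq_bigr => i _.
  have [Ww Wy] := wP (fib x' (s i)); have [Ww' _] := wP (fib x0 i).
  by apply: k_indep Ww Ww' Wy (sP i); rewrite ?p_fib.
have G_diff U V y : UU U -> UU V -> U y -> V y ->
    G V y - G U y = cech_cochain c U V * n%:Z.
  move=> Uu Vu Uy Vy; rewrite /G -sumrB.
  under eq_bigr => i _.
    have [Ww Wy] := wP (fib y i).
    rewrite (k_diff U V (fib y i)) ?p_fib//; over.
  by rewrite sumr_const card_ord -mulr_natr natz.
(* G U need not be constant on U, so U is cut into the level sets of G U. *)
pose cell U (m : int) := U `&` [set x | G U x = m].
pose VV : set (set X) := [set V | exists U m, UU U /\ V = cell U m].
have /choice[rm rmP] (V : set X) : exists um : set X * int,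
    VV V -> UU um.1 /\ V = cell um.1 um.2.
  have [[U [m Um]]|nV] := pselect (VV V); first by exists (U, m).
  by exists (set0, 0).
apply/cech_H1_eqP; exists VV, (fun V => (rm V).1), (fun=> setT); split.
- split=> [V /rmP[Uu ->]|].
    rewrite openE => x0 [Ux0 <-].
    have near_U : \forall x \near x0, (rm V).1 x.
      by apply: open_nbhs_nbhs; split => //; exact: UUo.
    by apply: filterS2 near_U (G_locconst _ _ Uu Ux0).
  rewrite -subTset => y _; have : setT y by [].
  by rewrite -UUT => -[U Uu Uy]; exists (cell U (G U y)) => //; exists U, (G U y).
- by move=> V /rmP[Uu VE]; split => //; rewrite {1}VE => y [].
- by [].
exists (fun V => ((rm V).2 %/ n%:Z)%Z) => V V' /rmP[Uu VE] /rmP[Uu' VE'].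
move=> [y []]; rewrite {1}VE {1}VE' => -[Uy Gy] [Uy' Gy'] /=; rewrite subr0.
have /eqP := G_diff _ _ _ Uu Uu' Uy Uy'; rewrite Gy Gy' subr_eq => /eqP ->.
by rewrite divzMDl ?addrK// eqz_nat -lt0n.
Qed.

End cech_transfer.

(** * Characters of an Arens-Hoffman extension *)

Lemma gelfand_evalE (K : numFieldType) (A : comBanachAlgType K)
    (phi psi : max_ideal_space A) :
  gelfand_eval phi =1 gelfand_eval psi -> phi = psi.
Proof.
move: phi psi => [f cf] [g cg]; rewrite /gelfand_eval /= => /funext fg.
move: cf cg; rewrite fg => -[[cf1] [cf2] [cf3]] [[cg1] [cg2] [cg3]].
rewrite (Prop_irrelevance cf1 cg1) (Prop_irrelevance cf2 cg2).
by rewrite (Prop_irrelevance cf3 cg3).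
Qed.

Lemma gelfand_cvgP (K : numFieldType) (A : comBanachAlgType K) (T : Type)
    (F : set_system T) (f : T -> max_ideal_space A) (phi : max_ideal_space A) :
  Filter F ->
  (forall a, (fun t => gelfand_eval (f t) a) @ F --> gelfand_eval phi a) <->
  f @ F --> phi.
Proof.
move=> FF; split=> [cvg_a|f_cvg a]; last first.
  have eval_cont := @initial_continuous (max_ideal_space A) _ (@gelfand_eval K A) phi.
  have := cvg_comp f (gelfand_eval (A:=A)) f_cvg eval_cont.
  by move=> /(@pointwise_cvgP A K^o _ _ _)/(_ a).
have cvg_eval : (fun t => gelfand_eval (f t)) @ F -->
    (gelfand_eval phi : {ptws A -> K^o}).
  exact/(@pointwise_cvgP A K^o).
move=> V [W [[O Oo <-] /= Ophi] OV].
apply: (filterS OV); apply: cvg_eval; exact: open_nbhs_nbhs.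
Qed.

Section arens_hoffman_characters.
Context (K : numFieldType) (A : comBanachAlgType K) (alpha : {poly A}) (t : K).
Context (alpha_monic : alpha \is monic) (alpha_deg : (1 < size alpha)%N).
Context (t_gt0 : 0 < t)
  (t_ge : \sum_(k < (size alpha).-1) `|alpha`_k| * t ^+ k <= t ^+ (size alpha).-1).

Local Notation Aalpha := (arens_hoffman alpha_monic alpha_deg t_gt0 t_ge).
Local Notation inj := (ah_inj alpha_monic alpha_deg t_gt0 t_ge).

Lemma mk_monicE : mk_monic alpha = alpha.
Proof. by rewrite /mk_monic alpha_deg alpha_monic. Qed.

Lemma ah_injE a : inj a = qpolyC alpha a :> {poly %/ alpha}.
Proof.
apply/val_inj; rewrite [LHS]in_qpoly_small//= size_polyC mk_monicE.
by apply: leq_ltn_trans alpha_deg; case: (a != 0).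
Qed.

Lemma ah_inj_is_zmod_morphism : zmod_morphism inj.
Proof.
by move=> a b; rewrite !ah_injE; exact: (raddfB (qpolyC alpha)).
Qed.

Lemma ah_inj_is_monoid_morphism : monoid_morphism inj.
Proof.
by split=> [|a b]; rewrite !ah_injE; [exact: rmorph1|exact: (rmorphM (qpolyC alpha))].
Qed.

Lemma ah_inj_is_scalable : scalable inj.
Proof.
by move=> c a; rewrite /ah_inj -[c *: a]mulr_algl polyCM mul_polyC in_qpolyZ.
Qed.

HB.instance Definition _ :=
  GRing.isZmodMorphism.Build A Aalpha inj ah_inj_is_zmod_morphism.
HB.instance Definition _ :=
  GRing.isMonoidMorphism.Build A Aalpha inj ah_inj_is_monoid_morphism.
HB.instance Definition _ :=
  GRing.isScalable.Build K A Aalpha *:%R inj ah_inj_is_scalable.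

Definition ah_restrict (psi : max_ideal_space Aalpha) : max_ideal_space A :=
  (psi : {lrmorphism Aalpha -> K^o}) \o inj.

Lemma ah_restrict_continuous : continuous ah_restrict.
Proof.
move=> psi; apply/(gelfand_cvgP _ _ (nbhs_filter psi)) => a.
have [_ /(_ _ (inj a))] := gelfand_cvgP id psi (nbhs_filter psi).
by apply; exact: cvg_id.
Qed.

Section character_at_root.
Variables (phi : max_ideal_space A) (z : K).
Let f := (phi : {lrmorphism A -> K^o}).
Hypothesis z_root : root (map_poly f alpha) z.

Definition ah_eval (q : Aalpha) : K^o := (map_poly f (q : {poly %/ alpha})).[z].

(** Reduction modulo [alpha] does not change the value at a root of [phi alpha];
    this makes evaluation at the root multiplicative on the extension. *)
Lemma ah_eval_in_qpoly (p : {poly A}) :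
  ah_eval (in_qpoly alpha p) = (map_poly f p).[z].
Proof.
rewrite [in RHS](Pdiv.RingMonic.rdivp_eq alpha_monic p).
rewrite rmorphD rmorphM !hornerE (rootP z_root) mulr0 add0r /ah_eval /=.
by rewrite mk_monicE.
Qed.

Lemma ah_eval_is_zmod_morphism : zmod_morphism ah_eval.
Proof. by move=> p q; rewrite /ah_eval raddfB/= !hornerE. Qed.

Lemma ah_eval_is_monoid_morphism : monoid_morphism ah_eval.
Proof.
split=> [|p q]; first by rewrite /ah_eval rmorph1 hornerE.
by rewrite [LHS]ah_eval_in_qpoly rmorphM hornerE.
Qed.

Lemma ah_eval_is_scalable : scalable ah_eval.
Proof.
move=> c q; rewrite /ah_eval [X in map_poly f X](_ : _ = c%:A *: (q : {poly A}))//.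
rewrite linearZ_LR hornerZ; congr (_ * _).
by apply: (etrans (linearZ_LR f c 1)); rewrite rmorph1; exact: mulr1.
Qed.

HB.instance Definition _ :=
  GRing.isZmodMorphism.Build Aalpha K^o ah_eval ah_eval_is_zmod_morphism.
HB.instance Definition _ :=
  GRing.isMonoidMorphism.Build Aalpha K^o ah_eval ah_eval_is_monoid_morphism.
HB.instance Definition _ :=
  GRing.isScalable.Build K Aalpha K^o *:%R ah_eval ah_eval_is_scalable.

Definition ah_character : max_ideal_space Aalpha := ah_eval.

Lemma ah_restrict_character : ah_restrict ah_character = phi.
Proof.
apply: gelfand_evalE => a; rewrite /gelfand_eval /= /ah_inj ah_eval_in_qpoly.
by rewrite map_polyC hornerE.
Qed.

End character_at_root.

End arens_hoffman_characters.

(** The transfer applies to the restriction of characters, the fibre over [phi]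
    being given by the roots of [phi alpha].  Continuity of the fibre is checked
    along ultrafilters: an ultrafilter converging to [phi0] that contains the
    bad characters would make the roots converge to those of [phi0 alpha], hence
    the fibre to the fibre over [phi0]. *)
Lemma arens_hoffman_H1 (K : numClosedFieldType) (A : comBanachAlgType K)
    (alpha : {poly A}) (t : K)
    (alpha_monic : alpha \is monic) (alpha_deg : (1 < size alpha)%N)
    (t_gt0 : 0 < t)
    (t_ge : \sum_(k < (size alpha).-1) `|alpha`_k| * t ^+ k
              <= t ^+ (size alpha).-1) :
  (forall x : cech_H1 (max_ideal_space
     (arens_hoffman alpha_monic alpha_deg t_gt0 t_ge)) int, x = 0) ->
  forall x : cech_H1 (max_ideal_space A) int, x = 0.
Proof.
set Aalpha := arens_hoffman _ _ _ _; pose n := (size alpha).-1.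
have n_gt0 : (0 < n)%N by rewrite /n -subn1 subn_gt0.
pose poly_at (phi : max_ideal_space A) : {poly K} :=
  map_poly (phi : {lrmorphism A -> K^o}) alpha.
have sz_alpha : size alpha = n.+1 by rewrite /n prednK// (leq_trans _ alpha_deg).
have mon phi : poly_at phi \is monic by rewrite monic_map.
have sz phi : size (poly_at phi) = n.+1.
  by rewrite size_map_poly_id0// (monicP alpha_monic) rmorph1 oner_neq0.
have coef_at phi k : (poly_at phi)`_k = gelfand_eval phi alpha`_k.
  by rewrite coef_map.
have /choice[zf zfP] phi : exists zf : ('I_n -> K) * ('I_n -> max_ideal_space Aalpha),
    [/\ poly_at phi = \prod_(i < n) ('X - (zf.1 i)%:P),
      forall i, ah_restrict (zf.2 i) = phi &
      forall i q, gelfand_eval (zf.2 i) q =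
        (map_poly (phi : {lrmorphism A -> K^o}) (q : {poly %/ alpha})).[zf.1 i]].
  have [s sE] := closed_field_poly_normal (poly_at phi).
  rewrite (monicP (mon _)) scale1r in sE.
  have sn : size s = n by have := sz phi; rewrite sE size_prod_XsubC => -[].
  have s_root (i : 'I_n) : root (poly_at phi) s`_i.
    by rewrite sE root_prod_XsubC mem_nth// sn.
  exists (fun i : 'I_n => s`_i,
          fun i => ah_character alpha_monic alpha_deg t_gt0 t_ge (s_root i)).
  split => //=.
    by rewrite sE (big_nth 0) big_mkord sn.
  by move=> i; exact: ah_restrict_character.
pose z phi := (zf phi).1; pose fib phi := (zf phi).2.
apply: (@cech_H1_transfer _ _ (@ah_restrict _ _ _ _ _ _ _ _) n fib n_gt0) => //.
- exact: ah_restrict_continuous.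
- by move=> phi i; have [_ ->] := zfP phi.
move=> phi0 O O_nbhs; apply: contrapT => not_near.
pose good := [set phi | exists s : {perm 'I_n}, forall i, O i (fib phi (s i))].
have bad_proper : ProperFilter (within (~` good) (nbhs phi0)).
  split=> [bad0|]; last exact: within_filter.
  have {}bad0 : nbhs phi0 [set phi | ~ good phi -> False] := bad0.
  by apply: not_near; apply: filterS bad0 => phi /contrapT.
have [F [FU bad_F]] := ultraFilterLemma bad_proper.
have FF : ProperFilter F := @ultra_proper _ _ FU.
have F_phi0 : id @ F --> phi0.
  by move=> V Vphi0; apply: bad_F; apply: filterS Vphi0.
have F_bad : F (~` good) by apply: bad_F; exact: withinT.
have map_coef_cvg (q : {poly A}) k :
    (fun phi => (map_poly (phi : {lrmorphism A -> K^o}) q)`_k : K^o) @ F -->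
    ((map_poly (phi0 : {lrmorphism A -> K^o}) q)`_k : K^o).
  rewrite coef_map; under eq_fun do rewrite coef_map.
  exact: ((gelfand_cvgP id phi0 _).2 F_phi0 q`_k).
have coef_cvg k : (fun phi => (poly_at phi)`_k : K^o) @ F --> ((poly_at phi0)`_k : K^o).
  exact: map_coef_cvg.
have polyE phi : poly_at phi = \prod_(i < n) ('X - (z phi i)%:P) by have [] := zfP phi.
have [s [sE s_cvg]] := ultra_roots_cvg FU mon sz (mon phi0) (sz phi0) coef_cvg polyE.
have /tuple_permP[sigma sigmaE] : perm_eq [tuple z phi0 i | i < n] [tuple s i | i < n].
  apply: (@prod_XsubC_eq K).
  rewrite !big_tuple; under eq_bigr do rewrite tnth_mktuple.
  rewrite -polyE.
  by under eq_bigr do rewrite tnth_mktuple; rewrite -sE.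
have s_sigma i : z phi0 i = s (sigma i).
  have := congr1 (fun r => nth 0 r i) sigmaE.
  by rewrite -!tnth_nth !tnth_map !tnth_ord_tuple.
have fib_cvg i : (fun phi => fib phi (sigma i)) @ F --> fib phi0 i.
  apply/gelfand_cvgP => q.
  have [_ _ /(_ i q) ->] := zfP phi0; rewrite -/(z phi0 i) s_sigma.
  under eq_fun => phi.
    have [_ _ /(_ (sigma i) q) ->] := zfP phi.
    rewrite (horner_coef_wide _ (size_poly _ _)); over.
  rewrite (horner_coef_wide _ (size_poly _ _)).
  apply: (@cvg_bigsum K K^o) => k _.
  apply: (@cvgM K); first exact: map_coef_cvg.
  rewrite -(card_ord k) -prodr_const; under eq_fun do rewrite -prodr_const.
  by apply: cvg_bigprod => _ _; exact: s_cvg.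
have near_O i : \forall phi \near F, O i (fib phi (sigma i)).
  have [Oo Oi] := O_nbhs i; apply: fib_cvg; exact: open_nbhs_nbhs.
have FH := filter_forall FF near_O.
have [phi [phi_bad phi_good]] := filter_ex (filterI F_bad FH).
by apply: phi_bad; exists sigma.
Qed.

(** * The exponential of a commutative Banach algebra *)

Section banach_algebra.
Local Open Scope complex_scope.
Context (R : realType) (A : comBanachAlgType R[i]).
Local Notation K := R[i].
Implicit Types x y c : A.

(** Norms take their values in [R[i]]; [rnorm] brings them back to [R], where
    limits can be compared. *)
Definition rnorm (x : A) : R := complex.Re `|x|.

Lemma rnormE x : (rnorm x)%:C = `|x|.
Proof. by rewrite /rnorm RRe_real// normr_real. Qed.

Lemma rnorm_ge0 x : 0 <= rnorm x.
Proof. by rewrite -ler0c rnormE. Qed.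

Lemma norm_algM x y : `|x * y| <= `|x| * `|y|.
Proof. exact: alg_normM. Qed.

Lemma norm_algX x k : `|x ^+ k| <= `|x| ^+ k.
Proof.
elim: k => [|k IH]; first by rewrite !expr0 [leLHS]alg_norm1.
by rewrite !exprS (le_trans (norm_algM _ _))// ler_wpM2l.
Qed.

Lemma cvg0_bound (T : Type) (F : set_system T) {FF : Filter F} (f : T -> A) (u : T -> R) :
  u @ F --> 0 -> (\forall t \near F, `|f t| <= (u t)%:C) -> f @ F --> 0.
Proof.
move=> u0 fu; apply/cvgr0Pnorm_lt => e e0.
have eE : e = (complex.Re e)%:C by rewrite RRe_real// gtr0_real.
have Re0 : 0 < complex.Re e by rewrite -ltcR -eE.
have /cvgr0Pnorm_lt/(_ _ Re0) u_small := u0.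
apply: filterS2 fu u_small => t ft ut.
by rewrite (le_lt_trans ft)// eE ltcR (le_lt_trans (ler_norm _)).
Qed.

Lemma cvg_rnorm (T : Type) (F : set_system T) {FF : Filter F} (f : T -> A) (a : A) :
  f @ F --> a -> (fun t => rnorm (f t - a)) @ F --> 0.
Proof.
move=> fa; apply/cvgr0Pnorm_lt => e e0.
have eC : 0 < e%:C by rewrite ltcR.
have /cvgrPdist_lt/(_ _ eC) := fa; apply: filterS => t.
by rewrite distrC -rnormE ltcR ger0_norm// rnorm_ge0.
Qed.

Lemma cvg_algM (T : Type) (F : set_system T) {FF : Filter F} (f g : T -> A) (a b : A) :
  f @ F --> a -> g @ F --> b -> (fun t => f t * g t) @ F --> a * b.
Proof.
move=> fa gb.
apply/subr_cvg0.
pose u t := rnorm (f t - a) * rnorm (g t - b) + (rnorm (f t - a) * rnorm b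
  + rnorm a * rnorm (g t - b)).
apply: (@cvg0_bound _ _ _ _ u).
  have fa0 := @cvg_rnorm _ _ FF _ _ fa; have gb0 := @cvg_rnorm _ _ FF _ _ gb.
  have -> : 0 = 0 * 0 + (0 * rnorm b + rnorm a * 0) :> R by rewrite !mul0r mulr0 !addr0.
  apply: (@cvgD R R^o); first exact: (@cvgM R _ _ _ (fun t => rnorm (f t - a))).
  by apply: (@cvgD R R^o); [exact: (@cvgMr_tmp R)|exact: (@cvgMl_tmp R)].
apply: nearW => t.
have -> : f t * g t - a * b = (f t - a) * (g t - b) + ((f t - a) * b + a * (g t - b)).
  by ring.
rewrite (le_trans (ler_normD _ _))// rmorphD rmorphM /= !rnormE.
apply: lerD; first exact: norm_algM.
rewrite (le_trans (ler_normD _ _))// rmorphD !rmorphM /= !rnormE.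
by apply: lerD; exact: norm_algM.
Qed.

Lemma cvg_algX (T : Type) (F : set_system T) {FF : Filter F} (f : T -> A) (a : A) k :
  f @ F --> a -> (fun t => f t ^+ k) @ F --> a ^+ k.
Proof.
move=> fa; elim: k => [|k IH].
  by rewrite expr0; under eq_fun do rewrite expr0; exact: cvg_cst.
by rewrite exprS; under eq_fun do rewrite exprS; exact: cvg_algM.
Qed.

Lemma cvg_algprod (T I : Type) (F : set_system T) {FF : Filter F}
    (r : seq I) (P : pred I) (f : I -> T -> A) (l : I -> A) :
  (forall i, P i -> f i @ F --> l i) ->
  (fun t => \prod_(i <- r | P i) f i t) @ F --> \prod_(i <- r | P i) l i.
Proof. by apply: cvg_big => g h a b; exact: cvg_algM. Qed.

Lemma cvg_horner (T : Type) (F : set_system T) {FF : Filter F}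
    (p : {poly A}) (f : T -> A) (a : A) :
  f @ F --> a -> (fun t => p.[f t]) @ F --> p.[a].
Proof.
move=> fa; rewrite horner_coef; under eq_fun do rewrite horner_coef.
apply: cvg_bigsum => k _; apply: cvg_algM; first exact: cvg_cst.
exact: cvg_algX.
Qed.

Lemma cvg_inv_succ x : (fun m : nat => (m.+1%:R : K)^-1 *: x) @ \oo --> (0 : A).
Proof.
apply: (@cvg0_bound _ _ _ _ (fun m => harmonic m * rnorm x)).
  by rewrite -(mul0r (rnorm x)); apply: cvgMr_tmp; exact: cvg_harmonic.
apply: nearW => m; rewrite normrZ rmorphM /= rnormE fmorphV rmorph_nat.
by rewrite ger0_norm// invr_ge0.
Qed.

Lemma exp_partial_le (r : R) m : 0 <= r ->
  \sum_(k < m) (k`!%:R)^-1 * r ^+ k <= expR r.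
Proof.
move=> r0; rewrite (eq_bigr (fun k : 'I_m => exp_coeff r k)); last first.
  by move=> k _; rewrite /exp_coeff/= mulrC.
rewrite -(big_mkord xpredT (exp_coeff r)).
apply: (nondecreasing_cvgn_le (u_ := series (exp_coeff r))).
  by apply: nondecreasing_series => k _ _; exact: exp_coeff_ge0.
exact: is_cvg_series_exp_coeff.
Qed.

Definition exp_term x k : A := (k`!%:R : K)^-1 *: x ^+ k.

Lemma norm_exp_term x k : `|exp_term x k| <= (exp_coeff (rnorm x) k)%:C.
Proof.
rewrite /exp_term /exp_coeff /= normrZ mulrC rmorphM rmorphXn /= rnormE.
rewrite fmorphV rmorph_nat ger0_norm ?invr_ge0 ?ler0n//.
by rewrite ler_wpM2r ?invr_ge0 ?ler0n// norm_algX.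
Qed.

Lemma cvg_exp_series x : series (exp_term x) @ \oo --> banach_exp x.
Proof.
suff : cvgn (series (exp_term x)) by [].
apply/cauchy_cvgP/cauchy_seriesP => e e0.
have eE : e = (complex.Re e)%:C by rewrite RRe_real// gtr0_real.
have Re0 : 0 < complex.Re e by rewrite -ltcR -eE.
have /cauchy_cvgP/cauchy_seriesP/(_ _ Re0) := is_cvg_series_exp_coeff (rnorm x).
apply: filterS => -[p q] /= pq; rewrite (le_lt_trans (ler_norm_sum _ _ _))//.
rewrite eE; apply: (@le_lt_trans _ _ (\sum_(p <= k < q) exp_coeff (rnorm x) k)%:C).
  by rewrite rmorph_sum; apply: ler_sum => k _; exact: norm_exp_term.
by rewrite ltcR (le_lt_trans (ler_norm _)).
Qed.

Lemma ffact_le_expn M k : (M ^_ k <= M ^ k)%N.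
Proof.
by elim: k => [|k IH]; rewrite ?ffactn0// ffactnSr expnSr leq_mul// leq_subr.
Qed.

(** The first-order loss [1 - k ^ 2 / M <= M ^_ k / M ^ k], cleared of fractions. *)
Lemma expn_le_ffact M k : (k <= M)%N -> (M ^ k * M <= M ^_ k * M + k ^ 2 * M ^ k)%N.
Proof.
elim: k => [|k IH] kM; first by rewrite ffactn0 expn0 leq_addr.
have {}IH := IH (ltnW kM).
rewrite ffactnSr expnSr.
have := ffact_le_expn M k; move: IH; set X := (M ^ k)%N; set Y := (M ^_ k)%N.
rewrite -{-3 4}(subnKC (ltnW kM)); set d := (M - k)%N.
nia.
Qed.

(** With [M = m.+1], the two polynomials in [x] have coefficients [1 / k!] and
    ['C(M, k) / M ^ k], whose difference is at most [k ^ 2 / (M k!)]; bounding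
    [k ^ 2] by [4 ^ k] leaves the exponential series at [4 * rnorm x]. *)
Lemma exp_partial_vs_power x m :
  `|series (exp_term x) m.+2 - (1 + (m.+1%:R : K)^-1 *: x) ^+ m.+1| <=
    (harmonic m * expR (4 * rnorm x))%:C.
Proof.
set M := m.+1; rewrite exprDn /series/= big_mkord -sumrB.
rewrite (le_trans (ler_norm_sum _ _ _))//.
rewrite (@le_trans _ _ (\sum_(k < M.+1)
    (harmonic m * ((k`!%:R)^-1 * (4 * rnorm x) ^+ k))%:C))//.
  apply: ler_sum => k _.
  have -> : exp_term x k - 1 ^+ (M - k) * ((M%:R)^-1 *: x) ^+ k *+ 'C(M, k) =
     ((k`!%:R)^-1 - (M%:R)^-1 ^+ k *+ 'C(M, k) : K) *: x ^+ k.
    by rewrite expr1n mul1r exprZn scalerBl /exp_term scalerMnl.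
  rewrite normrZ.
  have kM : (k <= M)%N by rewrite -ltnS.
  have M0 : (M%:R : K) != 0 by rewrite pnatr_eq0.
  have Mk0 : (0 : K) < M%:R ^+ k by rewrite exprn_gt0// ltr0n.
  have kf0 : (0 : K) < k`!%:R by rewrite ltr0n fact_gt0.
  have -> : ((k`!%:R)^-1 - (M%:R)^-1 ^+ k *+ 'C(M, k) : K) =
     (k`!%:R)^-1 * (1 - (M ^_ k)%:R / (M ^ k)%:R).
    rewrite -bin_ffact natrM natrX mulrBr mulr1; congr (_ - _).
    by rewrite -[LHS]mulr_natr exprVn; field; rewrite ?gt_eqF.
  rewrite normrM ger0_norm ?invr_ge0 ?(ltW kf0)//.
  have bnd : `|1 - (M ^_ k)%:R / (M ^ k)%:R : K| <= (k ^ 2)%:R / M%:R.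
    rewrite ger0_norm; last first.
      by rewrite subr_ge0 ler_pdivrMr ?ltr0n ?expn_gt0// mul1r ler_nat ffact_le_expn.
    have eM0 : (0 : K) < (M ^ k * M)%:R by rewrite ltr0n muln_gt0 expn_gt0.
    rewrite lerBlDr (_ : _ + _ = (M ^_ k * M + k ^ 2 * M ^ k)%:R / (M ^ k * M)%:R).
      by rewrite ler_pdivlMr// mul1r ler_nat expn_le_ffact.
    by rewrite natrD !natrM natrX; field; rewrite M0 gt_eqF.
  apply: (@le_trans _ _ ((k`!%:R)^-1 * ((4 ^ k)%:R / M%:R) * (rnorm x ^+ k)%:C)).
    apply: ler_pM => //; first by rewrite mulr_ge0// ?invr_ge0// ltW.
      apply: ler_wpM2l; first by rewrite invr_ge0 ltW.
      rewrite (le_trans bnd)// ler_wpM2r ?invr_ge0// ler_nat.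
      rewrite (_ : 4 ^ k = (2 ^ k) ^ 2)%N; last by rewrite -expnM mulnC expnM.
      by rewrite leq_exp2r// ltnW// ltn_expl.
    by rewrite rmorphXn /= rnormE norm_algX.
  rewrite exprMn !rmorphM /= !fmorphV !rmorphXn /= !rmorph_nat natrX.
  by rewrite le_eqVlt; apply/orP; left; apply/eqP; ring.
rewrite -rmorph_sum lecR -mulr_sumr ler_wpM2l ?invr_ge0//.
by rewrite exp_partial_le// mulr_ge0// rnorm_ge0.
Qed.

Lemma exp_subXn_le x y (B : R) M : 0 <= B -> `|x| <= B%:C -> `|y| <= B%:C ->
  `|x ^+ M.+1 - y ^+ M.+1| <= `|x - y| * (M.+1%:R * B ^+ M)%:C.
Proof.
move=> B0 xB yB; rewrite subrXX (le_trans (norm_algM _ _))// ler_wpM2l//.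
rewrite (le_trans (ler_norm_sum _ _ _))//.
rewrite (@le_trans _ _ (\sum_(i < M.+1) (B ^+ M)%:C))//; last first.
  by rewrite sumr_const card_ord -[leLHS]mulr_natl rmorphM /= rmorph_nat.
have pow (u : A) k : `|u| <= B%:C -> `|u ^+ k| <= B%:C ^+ k.
  move=> uB; rewrite (le_trans (norm_algX _ _))// lerXn2r// nnegrE//.
  by rewrite ler0c.
apply: ler_sum => i _; rewrite (le_trans (norm_algM _ _))//.
have iM : (i <= M)%N by rewrite -ltnS.
have -> : B ^+ M = B ^+ (M - i) * B ^+ i by rewrite -exprD subnK.
by rewrite rmorphM !rmorphXn /= ler_pM// pow.
Qed.

(** Only the first-order behaviour of [y m] matters: [y m] and [1 + c / M] differ
    by [o(1 / M)] and both have norm at most [1 + C / M], so their [M]-th powers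
    differ by at most [M * o(1 / M) * expR C], where [M = m.+1]. *)
Lemma cvg_power_exp (y : nat -> A) c :
  (fun m => (m.+1%:R : K) *: (y m - 1)) @ \oo --> c ->
  (fun m => y m ^+ m.+1) @ \oo --> banach_exp c.
Proof.
move=> yc; pose x m := 1 + (m.+1%:R : K)^-1 *: c.
have m0 m : (m.+1%:R : K) != 0 by rewrite pnatr_eq0.
pose d m := rnorm ((m.+1%:R : K) *: (y m - 1) - c).
have d0 : d @ \oo --> 0 by exact: cvg_rnorm.
have yxE m : `|y m - x m| = (harmonic m * d m)%:C.
  have -> : y m - x m = (m.+1%:R : K)^-1 *: ((m.+1%:R : K) *: (y m - 1) - c).
    by rewrite scalerBr scalerA mulVf// scale1r /x opprD addrA.
  by rewrite normrZ rmorphM /= /d rnormE fmorphV rmorph_nat ger0_norm ?invr_ge0.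
pose C := rnorm c + 1.
have C0 : 0 <= C by rewrite addr_ge0// rnorm_ge0.
pose B m : R := 1 + harmonic m * C.
have h0 m : 0 <= harmonic m :> R by rewrite /= invr_ge0.
have B0 m : 0 <= B m by rewrite addr_ge0// mulr_ge0.
have x_le m : `|x m| <= (1 + harmonic m * rnorm c)%:C.
  rewrite (le_trans (ler_normD _ _))// rmorphD rmorphM /= rnormE.
  rewrite normrZ [X in X + _ <= _]alg_norm1 lerD2l ger0_norm ?invr_ge0//.
  by rewrite fmorphV rmorph_nat.
have xB m : `|x m| <= (B m)%:C.
  by rewrite (le_trans (x_le m))// lecR lerD2l ler_wpM2l// lerDl.
have yB : \forall m \near \oo, `|y m| <= (B m)%:C.
  have /cvgr0Pnorm_lt/(_ _ ltr01) := d0; apply: filterS => m dm.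
  rewrite -[y m](subrK (x m)) (le_trans (ler_normD _ _))// addrC.
  rewrite (le_trans (lerD (x_le m) (lexx _)))// yxE -rmorphD lecR.
  rewrite /B /C mulrDr mulr1 addrA lerD2l ger_pMr//; last by rewrite invr_gt0.
  by rewrite ltW// (le_lt_trans (ler_norm _)).
have diff1 : (fun m => y m ^+ m.+1 - x m ^+ m.+1) @ \oo --> 0.
  apply: (@cvg0_bound _ _ _ _ (fun m => d m * expR C)).
    by rewrite -(mul0r (expR C)); exact: (@cvgMr_tmp R).
  apply: filterS yB => m yBm.
  rewrite (le_trans (exp_subXn_le _ (B0 m) yBm (xB m)))// yxE -rmorphM lecR.
  rewrite -mulrA mulrCA ler_wpM2l ?rnorm_ge0// mulrA mulVf ?pnatr_eq0// mul1r.
  rewrite (@le_trans _ _ (B m ^+ m.+1))//.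
    by rewrite exprS ler_peMl ?exprn_ge0// lerDl mulr_ge0.
  rewrite -[C](@mulVKf _ m.+1%:R) ?pnatr_eq0// expRM_natl.
  rewrite lerXn2r ?nnegrE ?expR_ge0//.
  exact: expR_ge1Dx.
have diff2 : (fun m => series (exp_term c) m.+2 - x m ^+ m.+1) @ \oo --> 0.
  apply: (@cvg0_bound _ _ _ _ (fun m => harmonic m * expR (4 * rnorm c))).
    by rewrite -(mul0r (expR (4 * rnorm c))); apply: (@cvgMr_tmp R); exact: cvg_harmonic.
  by apply: nearW => m; exact: exp_partial_vs_power.
have ser : (fun m => series (exp_term c) m.+2) @ \oo --> banach_exp c.
  have := @cvg_exp_series c; rewrite -cvg_shiftS -cvg_shiftS; exact.
have -> : (fun m => y m ^+ m.+1) = (fun m => (y m ^+ m.+1 - x m ^+ m.+1) -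
   (series (exp_term c) m.+2 - x m ^+ m.+1) + series (exp_term c) m.+2).
  by apply/funext => m; rewrite opprB addrA subrK subrK.
rewrite -[banach_exp c](add0r) -[X in X + _](subrr 0).
by apply: cvgD ser; exact: cvgB.
Qed.

End banach_algebra.

Section exponential.
Local Open Scope complex_scope.
Context (R : realType) (A : comBanachAlgType R[i]).
Local Notation K := R[i].
Implicit Types x y : A.

Lemma cvg_alg_unique (f : nat -> A) x y :
  f @ \oo --> x -> f @ \oo --> y -> x = y.
Proof. move=> fx fy; exact: (@cvg_unique _ (@norm_hausdorff K A) _ _ _ _ fx fy). Qed.

Lemma cvg_one_plus_exp x :
  (fun m => (1 + (m.+1%:R : K)^-1 *: x) ^+ m.+1) @ \oo --> banach_exp x.
Proof.
apply: cvg_power_exp; rewrite (_ : (fun m => _) = fun=> x); first exact: cvg_cst.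
by apply/funext => m; rewrite addrC addKr scalerA divff ?pnatr_eq0// scale1r.
Qed.

Lemma banach_expD x y : banach_exp (x + y) = banach_exp x * banach_exp y.
Proof.
pose z m : A := (1 + (m.+1%:R : K)^-1 *: x) * (1 + (m.+1%:R : K)^-1 *: y).
apply: (@cvg_alg_unique (fun m => z m ^+ m.+1)).
  apply: cvg_power_exp.
  rewrite (_ : (fun m => _) = fun m => x + y + (m.+1%:R : K)^-1 *: (x * y)); last first.
    apply/funext => m.
    have -> : z m - 1 = (m.+1%:R : K)^-1 *: (x + y + (m.+1%:R : K)^-1 *: (x * y)).
      by rewrite /z !scalerDr scalerAr scalerAl; ring.
    by rewrite scalerA divff ?pnatr_eq0// scale1r.
  by rewrite -[X in _ --> X]addr0; apply: cvgD; [exact: cvg_cst|exact: cvg_inv_succ].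
under eq_fun do rewrite /z exprMn.
by apply: cvg_algM; exact: cvg_one_plus_exp.
Qed.

Lemma banach_exp0 : banach_exp (0 : A) = 1.
Proof.
apply: (@cvg_alg_unique (fun m => (1 + (m.+1%:R : K)^-1 *: 0) ^+ m.+1)).
  exact: cvg_one_plus_exp.
by under eq_fun do rewrite scaler0 addr0 expr1n; exact: cvg_cst.
Qed.

Lemma banach_expMn x n : banach_exp (x *+ n) = banach_exp x ^+ n.
Proof.
elim: n => [|n IH]; first by rewrite mulr0n banach_exp0.
by rewrite mulrS banach_expD exprS IH.
Qed.

End exponential.

(** * Roots of unity are exponentials *)

Section unity_roots.
Context (R : realType).
Local Notation K := R[i].
Local Open Scope complex_scope.

Definition cis (t : R) : K := cos t +i* sin t.

Lemma cisD s t : cis (s + t) = cis s * cis t.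
Proof.
rewrite /cis cosD sinD; apply/eqP; rewrite eq_complex /= eqxx/=.
by rewrite addrC eqxx.
Qed.

Lemma cis0 : cis 0 = 1. Proof. by rewrite /cis cos0 sin0. Qed.

Lemma cisMn t n : cis (t *+ n) = cis t ^+ n.
Proof.
by elim: n => [|n IH]; rewrite ?mulr0n ?cis0// mulrS cisD IH exprS.
Qed.

Lemma cis_prim_root n : (0 < n)%N -> n.-primitive_root (cis (pi *+ 2 / n%:R)).
Proof.
move=> n0; have n0R : (n%:R : R) != 0 by rewrite pnatr_eq0 -lt0n.
rewrite /primitive_root_of_unity n0; apply/forallP => i; apply/eqP.
rewrite unity_rootE -cisMn.
have [->|] := eqVneq i.+1 n.
  by rewrite -[_ *+ n]mulr_natr divfK// /cis cos2pi sin2pi; apply/eqP.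
move=> i_neq; apply/negbTE/negP => /eqP [] /eqP.
pose x : R := pi * i.+1%:R / n%:R.
have -> : (pi *+ 2 / n%:R *+ i.+1 : R) = x *+ 2 by rewrite /x; field.
rewrite cos_mulr2n -[cos x ^+ 2](addrK (sin x ^+ 2)) cos2Dsin2.
(* x lies strictly between 0 and pi, while cos (x *+ 2) = 1 forces sin x = 0 *)
have : 0 < sin x.
  apply: sin_gt0_pi.
  have i_lt : (i.+1 < n)%N by rewrite ltn_neqAle i_neq ltn_ord.
  rewrite divr_gt0 ?mulr_gt0 ?pi_gt0 ?ltr0n//= ltr_pdivrMr ?ltr0n//.
  by rewrite ltr_pM2l ?pi_gt0// ltr_nat.
move=> sx /eqP cx _; have := exprn_gt0 2 sx.
by rewrite mulr2n in cx; move: cx; set s2 := sin x ^+ 2 => cx s2_gt0; lra.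
Qed.

Lemma cvg_harmonic_derive (f : R -> R) (df th : R) : is_derive (0 : R) (1 : R) f df ->
  (fun m : nat => m.+1%:R * (f (th / m.+1%:R) - f 0)) @ \oo --> th * df.
Proof.
move=> fdf.
have f_diff : differentiable f 0 by apply/derivable1_diffP; exact: ex_derive.
have D_th : 'D_th f 0 = th * df.
  by rewrite deriveE// diff1E// derive1E derive_val.
have : (fun h => h^-1 *: ((f \o shift 0) (h *: th) - f 0)) @ 0^' --> th * df.
  rewrite -D_th; exact: diff_derivable.
move=> lim.
have harm : (fun m : nat => m.+1%:R^-1 : R) @ \oo --> 0^'.
  move=> B B0; have {}B0 : nbhs (0 : R) [set x | x != 0 -> B x] := B0.
  have near_B : \forall m \near \oo, (m.+1%:R^-1 : R) != 0 -> B m.+1%:R^-1.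
    exact: (@cvg_harmonic R _ B0).
  by apply: filterS near_B => m Bm; apply: Bm; rewrite invr_eq0 pnatr_eq0.
have := cvg_comp _ _ harm lim.
rewrite (_ : _ \o _ = fun m : nat => m.+1%:R * (f (th / m.+1%:R) - f 0))//.
by apply/funext => m /=; rewrite addr0 invrK [_^-1 *: _]mulrC.
Qed.

Lemma norm_complex_le (a b : R) : `|a +i* b| <= (`|a| + `|b|)%:C.
Proof.
have -> : a +i* b = a%:C + 'i%C * b%:C by rewrite [LHS]complexE.
rewrite (le_trans (ler_normD _ _))// normrM rmorphD /= !normc_def /=.
rewrite !expr0n /= expr1n !addr0 add0r sqrtr1 mul1r lerD// lecR !sqrtr_sqr//.
Qed.

Section algebra.
Variable A : comBanachAlgType R[i].
Implicit Types x : A.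

(** The derivative of [cis] at 0 along the sequence [th / m.+1]; it is scaled by
    [x] so that the limit is taken in [A]. *)
Lemma cvg_cis_derive (th : R) x :
  (fun m => ((m.+1%:R : K) * (cis (th / m.+1%:R) - 1)) *: x) @ \oo --> (0 +i* th) *: x.
Proof.
pose u m : R := m.+1%:R * (cos (th / m.+1%:R) - cos 0) - th * - sin 0.
pose v m : R := m.+1%:R * (sin (th / m.+1%:R) - sin 0) - th * cos 0.
apply/subr_cvg0.
apply: (@cvg0_bound _ _ _ _ _ _ (fun m => (`|u m| + `|v m|) * rnorm x)).
  have u0 : u @ \oo --> 0.
    by apply/(@subr_cvg0 R R^o); exact: cvg_harmonic_derive.
  have v0 : v @ \oo --> 0.
    by apply/(@subr_cvg0 R R^o); exact: cvg_harmonic_derive.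
  have uv0 : (fun m => `|u m| + `|v m|) @ \oo --> 0.
    rewrite -[0 in X in _ --> X](addr0 0) -(@normr0 R R).
    by apply: (@cvgD R R^o); apply: (@cvg_norm R R^o).
  by rewrite -(mul0r (rnorm x)); exact: (@cvgMr_tmp R).
apply: nearW => m; rewrite -scalerBl normrZ rmorphM /= rnormE ler_wpM2r//.
have -> : (m.+1%:R : K) * (cis (th / m.+1%:R) - 1) - (0 +i* th) = u m +i* v m.
  rewrite -(rmorph_nat (real_complex R)) /u /v /cis cos0 sin0 oppr0 mulr0 mulr1 !subr0.
  apply/eqP; rewrite eq_complex /=.
  by rewrite !(mul0r, subr0, addr0) !eqxx.
exact: norm_complex_le.
Qed.

(** Orthogonal elements of sum 1 are idempotent, so powers of a combination are
    computed coefficientwise. *)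
Lemma orthogonal_sumX n (e : 'I_n -> A) (a : 'I_n -> K) k :
  \sum_i e i = 1 -> (forall i j, i != j -> e i * e j = 0) ->
  (\sum_i a i *: e i) ^+ k = \sum_i a i ^+ k *: e i.
Proof.
move=> e1 eo; have ee i : e i * e i = e i.
  rewrite -[RHS]mulr1 -e1 mulr_sumr (bigD1 i)//= big1 ?addr0// => j ji.
  by rewrite eo// eq_sym.
elim: k => [|k IH].
  by rewrite expr0 -e1; apply: eq_bigr => i _; rewrite expr0 scale1r.
rewrite exprS IH mulr_suml; apply: eq_bigr => i _.
rewrite mulr_sumr (bigD1 i)//= big1 ?addr0; last first.
  by move=> j ji; rewrite -scalerAl -scalerAr eo ?scaler0// eq_sym.
by rewrite -scalerAl -scalerAr ee scalerA -exprS.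
Qed.

(** With [w] a primitive [n]-th root of unity, the averages [e j] of the powers of
    [w ^- j *: u] are orthogonal, of sum 1, and [u * e j = w ^+ j *: e j].  Thus
    [u] is the [m.+1]-st power of the combination of the [e j] with coefficients
    [cis (th j / m.+1)], where [cis (th j) = w ^+ j], and [cvg_power_exp] turns
    this constant sequence of powers into an exponential. *)
Lemma exp_unity_root (u : A) n : (0 < n)%N -> u ^+ n = 1 ->
  exists w, banach_exp w = u.
Proof.
move=> n0 un; pose t0 : R := pi *+ 2 / n%:R; pose w := cis t0.
have w_prim : n.-primitive_root w := cis_prim_root n0.
have w0 : w != 0 by rewrite (prim_root_eq0 w_prim) -lt0n.
have nK : (n%:R : K) != 0 by rewrite pnatr_eq0 -lt0n.
pose v (j : 'I_n) : A := (w ^- j) *: u.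
pose e (j : 'I_n) : A := (n%:R : K)^-1 *: \sum_(k < n) v j ^+ k.
have vn j : v j ^+ n = 1.
  rewrite exprZn un -exprVn exprAC exprVn (prim_expr_order w_prim) invr1 expr1n.
  by rewrite scale1r.
(* (v j - 1) times the sum of the powers of v j is v j ^+ n - 1 = 0 *)
have ve j : v j * e j = e j.
  apply/eqP; rewrite -subr_eq0 -[X in _ - X]mul1r -mulrBl -scalerAr -subrX1.
  by rewrite vn subrr scaler0.
have ue j : u * e j = w ^+ j *: e j.
  by rewrite -[in RHS]ve /v -scalerAl scalerA divff ?scale1r// expf_neq0.
have e1 : \sum_j e j = 1.
  (* only the power k = 0 survives: for 0 < k < n the powers of w ^- k sum to 0 *)
  rewrite /e -scaler_sumr exchange_big/=.
  rewrite (bigD1 (Ordinal n0))//= [X in _ *: (_ + X)]big1 ?addr0; last first.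
    move=> k k_neq0.
    under eq_bigr do rewrite /v exprZn.
    rewrite -scaler_suml [X in X *: _](_ : _ = 0) ?scale0r//.
    pose z := w ^- k; have z1 : z - 1 != 0.
      rewrite subr_eq0 invr_eq1 -(prim_order_dvd w_prim) gtnNdvd// lt0n.
      by apply: contraNneq k_neq0 => k0; apply/eqP/val_inj.
    apply: (mulfI z1); rewrite mulr0 (eq_bigr (fun j : 'I_n => z ^+ j)).
      rewrite -subrX1 /z -exprVn exprAC exprVn (prim_expr_order w_prim).
      by rewrite invr1 expr1n subrr.
    by move=> j _; rewrite /z -!exprVn exprAC.
  under eq_bigr do rewrite expr0.
  by rewrite sumr_const card_ord -(@scaler_nat K A) scalerA mulVf// scale1r.
have eo i j : i != j -> e i * e j = 0.
  move=> ij; apply/eqP.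
  have : (w ^+ i - w ^+ j) *: (e i * e j) == 0.
    rewrite scalerBl [X in X - _]scalerAl [X in _ - X]scalerAr -!ue.
    by rewrite mulrA [u * e i]mulrC subrr.
  rewrite scaler_eq0 subr_eq0 (eq_prim_root_expr w_prim) !modn_small//.
  by rewrite -[(_ == _ :> nat)]/(i == j) (negbTE ij).
pose th (j : 'I_n) : R := t0 *+ j.
exists (\sum_j (0 +i* th j) *: e j).
pose y m := \sum_j cis (th j / m.+1%:R) *: e j.
apply: (@cvg_alg_unique _ _ (fun m => y m ^+ m.+1)).
  apply: cvg_power_exp.
  rewrite (_ : (fun m => _) =
    fun m => \sum_j ((m.+1%:R : K) * (cis (th j / m.+1%:R) - 1)) *: e j).
    by apply: cvg_bigsum => j _; exact: cvg_cis_derive.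
  apply/funext => m; rewrite /y -[in X in _ - X]e1 -sumrB scaler_sumr.
  by apply: eq_bigr => j _; rewrite -scalerA scalerBl scale1r.
have yu m : y m ^+ m.+1 = u.
  rewrite orthogonal_sumX// -[RHS]mulr1 -e1 mulr_sumr; apply: eq_bigr => j _.
  by rewrite -cisMn -[_ *+ m.+1]mulr_natr divfK ?pnatr_eq0// ue cisMn.
by under eq_fun do rewrite yu; exact: cvg_cst.
Qed.

End algebra.

End unity_roots.

(** * The determinant of an Arens-Hoffman extension *)

Section arens_hoffman_det.
Context (R : realType) (A : comBanachAlgType R[i]) (alpha : {poly A}) (t : R[i]).
Local Notation K := R[i].
Context (alpha_monic : alpha \is monic) (alpha_deg : (1 < size alpha)%N).
Context (t_gt0 : 0 < t)
  (t_ge : \sum_(k < (size alpha).-1) `|alpha`_k| * t ^+ k <= t ^+ (size alpha).-1).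

Local Notation Aalpha := (arens_hoffman alpha_monic alpha_deg t_gt0 t_ge).
Local Notation inj := (ah_inj alpha_monic alpha_deg t_gt0 t_ge).
Local Notation n := (size alpha).-1.
Local Notation Q := {poly %/ alpha}.

Lemma ah_dim_gt0 : (0 < n)%N.
Proof. by rewrite -ltnS prednK// (leq_trans _ alpha_deg). Qed.

Let an : size alpha = n.+1.
Proof. by rewrite prednK// (leq_trans _ alpha_deg). Qed.

Definition ah_X (l : nat) : Q := in_qpoly alpha 'X^l.

Lemma ah_XE (l : 'I_n) : ah_X l = 'X^l :> {poly A}.
Proof.
by rewrite /ah_X in_qpoly_small// size_polyXn mk_monicE// [X in (_ < X)%N]an ltnS.
Qed.

Lemma ah_expand (q : Q) : q = \sum_(l < n) (q : {poly A})`_l *: ah_X l.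
Proof.
apply/val_inj; rewrite /= poly_of_qpoly_sum.
rewrite (eq_bigr (fun l : 'I_n => (q : {poly A})`_l *: 'X^l)); last first.
  by move=> l _; rewrite -ah_XE.
rewrite -poly_def; apply/polyP => k; rewrite coef_poly.
case: ltnP => // nk; rewrite nth_default// (leq_trans _ nk)//.
by have := size_mk_monic q; rewrite [ltnRHS](_ : _ = n.+1) ?ltnS// mk_monicE.
Qed.

(** The matrix of multiplication by [q] in the basis of the powers of the coset of
    ['X], acting on row vectors; hence the reversed product in [ah_mxM]. *)
Definition ah_mx (q : Q) : 'M[A]_n := \matrix_(i, j) (q * ah_X i : {poly A})`_j.

Lemma ah_mxM (p q : Q) : ah_mx (p * q) = ah_mx q *m ah_mx p.
Proof.
apply/matrixP => i j; rewrite !mxE -mulrA [q * ah_X i]ah_expand mulr_sumr.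
rewrite poly_of_qpoly_sum coef_sum; apply: eq_bigr => l _.
by rewrite !mxE -scalerAr coefZ.
Qed.

Lemma ah_mx_scale (a : A) (q : Q) : ah_mx (a *: q) = a *: ah_mx q.
Proof. by apply/matrixP => i j; rewrite !mxE -scalerAl coefZ. Qed.

Lemma ah_mxD (p q : Q) : ah_mx (p + q) = ah_mx p + ah_mx q.
Proof. by apply/matrixP => i j; rewrite !mxE mulrDl poly_of_qpolyD coefD. Qed.

Lemma ah_mx1 : ah_mx 1 = 1%:M.
Proof.
apply/matrixP => i j; rewrite !mxE mul1r ah_XE coefXn.
by rewrite eq_sym.
Qed.

Definition ah_det (q : Aalpha) : A := \det (ah_mx q).

Lemma ah_detM (p q : Aalpha) : ah_det (p * q) = ah_det p * ah_det q.
Proof. by rewrite /ah_det ah_mxM det_mulmx mulrC. Qed.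

Lemma ah_det1 : ah_det 1 = 1.
Proof. by rewrite /ah_det ah_mx1 det1. Qed.

Lemma ah_detX (q : Aalpha) k : ah_det (q ^+ k) = ah_det q ^+ k.
Proof. by elim: k => [|k IH]; rewrite ?expr0 ?ah_det1// !exprS ah_detM IH. Qed.

Lemma ah_det_inj (a : A) : ah_det (inj a) = a ^+ n.
Proof.
rewrite /ah_det (_ : ah_mx _ = a%:M) ?det_scalar//.
rewrite -scalemx1 -ah_mx1 -ah_mx_scale; congr ah_mx.
by rewrite /ah_inj -[a%:P]mulr1 mul_polyC in_qpolyZ in_qpoly1.
Qed.

Lemma coef_ah_le (k : 'I_n) (q : Aalpha) :
  `|((q : Q) : {poly A})`_k| * t ^+ k <= `|q|.
Proof.
rewrite [leRHS](_ : _ = \sum_(k < n) `|((q : Q) : {poly A})`_k| * t ^+ k)//.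
rewrite (bigD1 k)//= lerDl; apply: sumr_ge0 => i _.
by rewrite mulr_ge0// exprn_ge0// ltW.
Qed.

Lemma cvg_ah_coef (f : nat -> Aalpha) (q : Aalpha) (k : 'I_n) :
  f @ \oo --> q ->
  (fun m => ((f m : Q) : {poly A})`_k) @ \oo --> ((q : Q) : {poly A})`_k.
Proof.
move=> fq; apply/cvgrPdist_lt => e e0.
have tk0 : 0 < t ^+ k by rewrite exprn_gt0.
have et0 : 0 < e * t ^+ k by rewrite mulr_gt0.
have /cvgrPdist_lt/(_ _ et0) near_f := fq.
apply: filterS near_f => m fm.
rewrite -(ltr_pM2r tk0) (le_lt_trans _ fm)//.
by rewrite -coefB; exact: (coef_ah_le k (q - f m)).
Qed.

Lemma cvg_ah_det (f : nat -> Aalpha) (q : Aalpha) :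
  f @ \oo --> q -> (fun m => ah_det (f m)) @ \oo --> ah_det q.
Proof.
move=> fq; rewrite /ah_det /determinant.
apply: cvg_bigsum => s _; apply: cvg_algM; first exact: cvg_cst.
apply: cvg_algprod => i _; rewrite mxE; under eq_fun do rewrite mxE.
apply: (cvg_ah_coef (f := fun m => f m * (ah_X i : Aalpha)) (q := q * (ah_X i : Aalpha))).
by apply: cvg_algM => //; exact: cvg_cst.
Qed.

(** The determinant of [1 + 'X * ah_mx b] is a polynomial with value 1 at 0. *)
Lemma ah_det_poly (b : Aalpha) : exists P : {poly A}, forall c : K,
  ah_det (1 + c *: b) = 1 + c *: P.[c%:A].
Proof.
pose P : {poly A} := \det (1%:M + 'X *: map_mx polyC (ah_mx b)).
have PE (c : A) : P.[c] = \det (1%:M + c *: ah_mx b).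
  rewrite -[P.[c]]/(horner_eval c P) -det_map_mx; congr (\det _).
  apply/matrixP => i j; rewrite !mxE.
  rewrite -[LHS]/(((i == j)%:R + 'X * ((b * ah_X i : {poly A})`_j)%:P).[c]).
  by case: eqP => _; rewrite !hornerE.
have /factor_theorem[S SE] : root (P - 1) 0.
  by rewrite rootE !hornerE PE scale0r addr0 det1 subrr.
exists S => c.
have -> : ah_det (1 + c *: b) = P.[c%:A].
  by rewrite PE /ah_det ah_mxD ah_mx1 -ah_mx_scale.
rewrite -[P](subrK 1) SE subr0 !hornerE addrC.
by rewrite mulr_algr.
Qed.

Lemma ah_det_exp (b : Aalpha) : exists c : A, ah_det (banach_exp b) = banach_exp c.
Proof.
have [P PE] := ah_det_poly b; exists P.[0].
apply: (@cvg_alg_unique _ _ (fun m => ah_det (1 + (m.+1%:R : K)^-1 *: b) ^+ m.+1)).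
  under eq_fun do rewrite -ah_detX.
  by apply: cvg_ah_det; exact: cvg_one_plus_exp.
apply: cvg_power_exp.
rewrite (_ : (fun m => _) = fun m : nat => P.[(m.+1%:R : K)^-1%:A]); last first.
  by apply/funext => m; rewrite PE addrC addKr scalerA divff ?pnatr_eq0// scale1r.
apply: cvg_horner; exact: cvg_inv_succ.
Qed.

(** Dividing the logarithm of [a ^+ n] by [n] leaves an [n]-th root of unity,
    which is an exponential too. *)
Lemma ah_exp_inj (a : A) : exp_set Aalpha (inj a) -> exp_set A a.
Proof.
move=> [b _ bE]; have [c] := ah_det_exp b; rewrite bE ah_det_inj => aE.
have n0 := ah_dim_gt0.
pose c' : A := (n%:R : K)^-1 *: c.
have c'n : c' *+ n = c.
  by rewrite -(@scaler_nat K A) scalerA divff ?scale1r// pnatr_eq0 -lt0n.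
have [w wE] : exists w, banach_exp w = a * banach_exp (- c').
  apply: (exp_unity_root n0).
  by rewrite exprMn aE -banach_expMn mulNrn c'n -banach_expD subrr banach_exp0.
exists (w + c') => //.
by rewrite banach_expD wE -mulrA -banach_expD addNr banach_exp0 mulr1.
Qed.

End arens_hoffman_det.

Theorem lemma3p2p2p1 (R : realType) (A : comBanachAlgType R[i])
    (alpha : {poly A}) (t : R[i])
    (alpha_monic : alpha \is monic) (alpha_deg : (1 < size alpha)%N)
    (t_gt0 : 0 < t)
    (t_ge : \sum_(k < (size alpha).-1) `|alpha`_k| * t ^+ k
              <= t ^+ (size alpha).-1) :
  let Aalpha : comBanachAlgType R[i] :=
    arens_hoffman alpha_monic alpha_deg t_gt0 t_ge in
  (forall a : A,
     exp_set Aalpha (ah_inj alpha_monic alpha_deg t_gt0 t_ge a) ->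
     exp_set A a)
  /\
  ((forall x : cech_H1 (max_ideal_space Aalpha) int, x = 0) ->
   forall x : cech_H1 (max_ideal_space A) int, x = 0).
Proof. by split; [exact: ah_exp_inj|exact: arens_hoffman_H1]. Qed.
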